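(* Let $n\ge 1$ be an integer and let $\Phi$ be the $n$-dimensional Matérn cluster process with parent intensity $\lambda_{\mathrm p}>0$, daughter intensity $\lambda_{\mathrm d}>0$ and cluster radius $r_{\mathrm d}>0$. Let $R_{\mathrm C}=\min_{\mathbf z\in\Phi}\|\mathbf z\|$ be the contact distance and $F_{R_{\mathrm C}}(r)=\mathbb P(R_{\mathrm C}\le r)$. Then for every $r>0$, \[ F_{R_{\mathrm C}}(r)=1-\exp\!\left(-v_n\, n\, \lambda_{\mathrm p}\int_0^{r+r_{\mathrm d}}\left(1-e^{-\lambda_{\mathrm d}A(r,r_{\mathrm d},x)}\right)x^{n-1}\,\mathrm dx\right) \] \[ =1-\exp\!\left(-v_n\lambda_{\mathrm p}\left((r+r_{\mathrm d})^n-|r-r_{\mathrm d}|^n e^{-\lambda_{\mathrm d}v_n\beta(r)^n}-n\int_{|r-r_{\mathrm d}|}^{r+r_{\mathrm d}}e^{-\lambda_{\mathrm d}A(r,r_{\mathrm d},x)}x^{n-1}\,\mathrm dx\right)\right). \]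
   Context: The $n$-dimensional Matérn cluster process (MCP): let $\Phi_{\mathrm p}=\{\mathbf x_i\}$ be a homogeneous Poisson point process in $\mathbb R^n$ of intensity $\lambda_{\mathrm p}$ (the parent process). To each parent $\mathbf x_i$ associate a daughter process $\Phi_{\mathrm d}^{(i)}$, a homogeneous Poisson point process of intensity $\lambda_{\mathrm d}$ restricted to the ball $\mathcal B(\mathrm o,r_{\mathrm d})$ of radius $r_{\mathrm d}$ centered at the origin; the daughter processes are independent of each other and of $\Phi_{\mathrm p}$. The MCP is $\Phi=\bigcup_i(\mathbf x_i+\Phi_{\mathrm d}^{(i)})$. Notation: $v_n$ is the volume of the unit ball in $\mathbb R^n$; $A(r,r_{\mathrm d},x)$ is the volume of the intersection of two $n$-dimensional balls of radii $r$ and $r_{\mathrm d}$ whose centers are at distance $x$; $\beta(r)=\min\{r,r_{\mathrm d}\}$. *)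

(* Defs.v *)
From HB Require Import structures.
From mathcomp Require Import all_boot all_order all_algebra.
From mathcomp Require Import all_classical all_reals all_analysis.
Set Implicit Arguments. Unset Strict Implicit. Unset Printing Implicit Defensive.
Import Order.TTheory GRing.Theory Num.Theory.
Local Open Scope classical_set_scope.
Local Open Scope ring_scope.
Local Open Scope card_scope.

(* Points of R^n are n-tuples of reals, with the product (= Borel) sigma-algebra
   provided by mathcomp-analysis. *)
Section Geometry.
Context {R : realType} {n : nat}.

Definition tadd (a b : n.-tuple R) : n.-tuple R := [tuple tnth a i + tnth b i | i < n].
Definition tsub (a b : n.-tuple R) : n.-tuple R := [tuple tnth a i - tnth b i | i < n].
Definition origin : n.-tuple R := [tuple (0 : R) | i < n].
Definition tnorm (x : n.-tuple R) : R := Num.sqrt (\sum_(i < n) tnth x i ^+ 2).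
Definition cball (c : n.-tuple R) (r : R) : set (n.-tuple R) :=
  [set x | tnorm (tsub x c) <= r].
Definition e1x (x : R) : n.-tuple R := [tuple if val i == 0%N then x else 0 | i < n].
Definition box (a b : n.-tuple R) : set (n.-tuple R) :=
  [set x | forall i, tnth a i <= tnth x i <= tnth b i].

(* mu is the n-dimensional Lebesgue measure: the (unique) measure on the
   Borel sets of R^n giving every box its volume. *)
Definition is_lebesgue_n (mu : {measure set (n.-tuple R) -> \bar R}) : Prop :=
  forall a b : n.-tuple R, (forall i, tnth a i <= tnth b i) ->
    mu (box a b) = (\prod_(i < n) (tnth b i - tnth a i))%:E.

Definition vball (mu : {measure set (n.-tuple R) -> \bar R}) : R :=
  fine (mu (cball origin 1)).

Definition Avol (mu : {measure set (n.-tuple R) -> \bar R}) (r rd x : R) : R :=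
  fine (mu (cball origin r `&` cball (e1x x) rd)).

End Geometry.

(* Poisson probability mass function (valid for every rate >= 0, incl. 0) *)
Definition pois {R : realType} (lam : R) (k : nat) : R :=
  lam ^+ k / (k`!)%:R * expR (- lam).

Section PointProcess.
Context {R : realType} {n : nat} {d : measure_display} {Omega : measurableType d}.
Variables (P : probability Omega R) (mu : {measure set (n.-tuple R) -> \bar R}).

Definition count_event (Phi : Omega -> set (n.-tuple R)) (B : set (n.-tuple R))
  (k : nat) : set Omega :=
  [set w | (Phi w `&` B) #= `I_k]%card.

Definition poisson_process (lam : R) (W : set (n.-tuple R))
  (Phi : Omega -> set (n.-tuple R)) : Prop :=
  (forall B k, measurable B -> measurable (count_event Phi B k)) /\
  forall (m : nat) (B : 'I_m -> set (n.-tuple R)) (k : 'I_m -> nat),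
    (forall i, measurable (B i) /\ (mu (B i `&` W) < +oo)%E) ->
    (forall i j, i != j -> B i `&` B j = set0) ->
    P (\bigcap_(i in [set: 'I_m]) count_event Phi (B i) (k i)) =
      (\prod_(i < m) pois (lam * fine (mu (B i `&` W))) (k i))%:E.

(* mutual independence of a family of classes of events (each class
   standing for the pi-system of finite intersections it generates) *)
Definition indep_classes (I : Type) (G : I -> set (set Omega)) : Prop :=
  forall (m : nat) (J : 'I_m -> I), injective J ->
  forall (l : 'I_m -> nat) (E : forall i : 'I_m, 'I_(l i) -> set Omega),
    (forall i j, G (J i) (E i j)) ->
    P (\bigcap_(i in [set: 'I_m]) \bigcap_(j in [set: 'I_(l i)]) E i j) =
      (\prod_(i < m) fine (P (\bigcap_(j in [set: 'I_(l i)]) E i j)))%:E.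

Definition parents (X : nat -> Omega -> n.-tuple R) (w : Omega) : set (n.-tuple R) :=
  range (fun i => X i w).

Definition mcp (X : nat -> Omega -> n.-tuple R) (D : nat -> Omega -> set (n.-tuple R))
  (w : Omega) : set (n.-tuple R) :=
  \bigcup_(i in [set: nat]) [set tadd (X i w) y | y in D i w].

Definition is_mcp (lp ld rd : R) (X : nat -> Omega -> n.-tuple R)
  (D : nat -> Omega -> set (n.-tuple R)) : Prop :=
  [/\ (forall i, measurable_fun [set: Omega] (X i)),
      (forall w, injective (fun i => X i w)),
      poisson_process lp [set: n.-tuple R] (parents X),
      (forall j, poisson_process ld (cball origin rd) (D j)) &
      indep_classes (fun o : option nat => match o with
        | None => [set E | exists i A, measurable A /\ E = X i @^-1` A]
        | Some j => [set E | exists B k, measurable B /\ E = count_event (D j) B k]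
        end)].

End PointProcess.

(* contact distance R_C = inf_{z in Phi} ||z|| (+oo if Phi is empty) *)
Definition contact_dist {R : realType} {n : nat} {T : Type}
  (Phi : T -> set (n.-tuple R)) (w : T) : \bar R :=
  ereal_inf [set (tnorm z)%:E | z in Phi w].

(* Main.v *)
Require Import Defs.
From HB Require Import structures.
From mathcomp Require Import all_boot all_order all_algebra.
From mathcomp Require Import all_classical all_reals all_analysis.
From mathcomp Require Import measurable_realfun ring lra.
Import Order.TTheory GRing.Theory Num.Theory.
Import numFieldNormedType.Exports.
Local Open Scope classical_set_scope.
Local Open Scope ring_scope.

(* Write b(x, s) for the ball of centre x and radius s and b(s) for b(0, s).  Conditionally on the
   parents, the cluster of a parent at x misses b(s) with probability
   exp(- ld * mu(b(-x, s) /\ b(rd))), so that the probability generating functional of the Poisson parents gives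
     P(no point in b(s)) = exp(- lp * int (1 - exp(- ld * mu(b(-x, s) /\ b(rd)))) dx).
   Independence is only available for fixed sets, so the position of each parent is first rounded to
   a countable grid: for countably many cells the formula reduces to independence, to the joint law
   of the counts of parents in finitely many cells, and to a monotone limit.  The contact distance
   exceeds r iff for fine enough grids the rounded process misses the slightly enlarged ball, and
   dominated convergence gives the formula at s = r.
   The measure of the lens depends only on |x| because mu is invariant under reflections, and
   integrating a function of |x| against mu has the density n * vn * x^(n-1). *)

(** * Euclidean space and Lebesgue measure *)

Section EuclideanSpace.
Context {R : realType} {n : nat}.
Implicit Types x y z : n.-tuple R.

(** The hypotheses fix the joint law of the numbers of parents in disjoint sets, but not the law of
    a single [X i]: the labelling is arbitrary. An expectation over the first m parents is therefore
    not computable by itself; only its limit in m is, because for large m a product over labels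
    depends on nothing but the counts. This is why each void probability is first written as the
    integral of a product over m labels. The law of the counts is available for finitely many cells
    of finite measure at a time, whereas a grid has infinitely many cells. All but M of them are
    merged into one whose target set is empty: it may hold infinitely many parents, yet each
    contributes a factor 1. Since [mu] is known only through boxes, its rotational symmetry has to
    be derived. It comes from the uniqueness of translation-invariant measures up to a factor, the
    unit ball fixing the factor; reflections suffice because one of them exchanges any two distinct
    points of equal norm. *)

Definition tdot x y : R := \sum_(i < n) tnth x i * tnth y i.

Definition tscale (c : R) x : n.-tuple R := [tuple c * tnth x i | i < n].

Lemma tnth_tadd x y i : tnth (tadd x y) i = tnth x i + tnth y i.
Proof. by rewrite tnth_mktuple. Qed.

Lemma tnth_tsub x y i : tnth (tsub x y) i = tnth x i - tnth y i.
Proof. by rewrite tnth_mktuple. Qed.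

Lemma tnth_tscale c x i : tnth (tscale c x) i = c * tnth x i.
Proof. by rewrite tnth_mktuple. Qed.

Lemma tnth_origin i : tnth (@origin R n) i = 0.
Proof. by rewrite tnth_mktuple. Qed.

Definition tnthE := (tnth_tadd, tnth_tsub, tnth_tscale, tnth_origin).

Lemma tdot_ge0 x : 0 <= tdot x x.
Proof. by apply: sumr_ge0 => i _; rewrite -expr2 sqr_ge0. Qed.

Lemma tnorm_sqr x : tnorm x ^+ 2 = tdot x x.
Proof.
rewrite /tnorm sqr_sqrtr; last by apply: sumr_ge0 => i _; rewrite sqr_ge0.
by apply: eq_bigr => i _; rewrite expr2.
Qed.

Lemma tnorm_ge0 x : 0 <= tnorm x.
Proof. exact: sqrtr_ge0. Qed.

Lemma tnorm_le x (r : R) : 0 <= r -> (tnorm x <= r) = (tdot x x <= r ^+ 2).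
Proof. by move=> r0; rewrite -tnorm_sqr ler_pXn2r// nnegrE tnorm_ge0. Qed.

Lemma tnorm_eq x y : tdot x x = tdot y y -> tnorm x = tnorm y.
Proof.
by rewrite -!tnorm_sqr => /eqP; rewrite eqrXn2 ?tnorm_ge0// => /eqP.
Qed.

Lemma tdotC x y : tdot x y = tdot y x.
Proof. by apply: eq_bigr => i _; rewrite mulrC. Qed.

Lemma tdotDl x y z : tdot (tadd x y) z = tdot x z + tdot y z.
Proof. by rewrite -big_split; apply: eq_bigr => i _; rewrite tnthE mulrDl. Qed.

Lemma tdotBl x y z : tdot (tsub x y) z = tdot x z - tdot y z.
Proof. by rewrite -sumrB; apply: eq_bigr => i _; rewrite tnthE mulrBl. Qed.

Lemma tdotZl c x z : tdot (tscale c x) z = c * tdot x z.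
Proof. by rewrite mulr_sumr; apply: eq_bigr => i _; rewrite tnthE mulrA. Qed.

Lemma tdotDr x y z : tdot z (tadd x y) = tdot z x + tdot z y.
Proof. by rewrite tdotC tdotDl !(tdotC z). Qed.

Lemma tdotBr x y z : tdot z (tsub x y) = tdot z x - tdot z y.
Proof. by rewrite tdotC tdotBl !(tdotC z). Qed.

Lemma tdotZr c x z : tdot z (tscale c x) = c * tdot z x.
Proof. by rewrite tdotC tdotZl (tdotC z). Qed.

Definition tdotE := (tdotDl, tdotBl, tdotZl, tdotDr, tdotBr, tdotZr).

(** Cauchy-Schwarz without division: the squared norm of |y|^2 x - (x.y) y equals |y|^2 (|x|^2 |y|^2
    - (x.y)^2). *)
Lemma tdot_le_tnorm x y : tdot x y <= tnorm x * tnorm y.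
Proof.
have [y0|y0] := eqVneq (tdot y y) 0.
  have y0i i : tnth y i = 0.
    move/eqP: y0; rewrite psumr_eq0 => [/allP/(_ i)|j _]; last first.
      by rewrite -expr2 sqr_ge0.
    by rewrite mem_index_enum -expr2 sqrf_eq0 => /(_ isT)/eqP.
  rewrite /tdot big1 ?mulr_ge0 ?tnorm_ge0// => i _.
  by rewrite y0i mulr0.
have yp : 0 < tdot y y by rewrite lt_neqAle eq_sym y0 tdot_ge0.
have := tdot_ge0 (tsub (tscale (tdot y y) x) (tscale (tdot x y) y)).
have -> : tdot (tsub (tscale (tdot y y) x) (tscale (tdot x y) y))
     (tsub (tscale (tdot y y) x) (tscale (tdot x y) y)) =
   tdot y y * (tdot x x * tdot y y - tdot x y ^+ 2).
  by rewrite !tdotE (tdotC y x); ring.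
rewrite pmulr_rge0// subr_ge0 -!tnorm_sqr -exprMn => h.
apply: (le_trans (ler_norm _)).
by rewrite -(@ler_pXn2r _ 2) ?nnegrE ?mulr_ge0 ?tnorm_ge0// -normrX ger0_norm ?sqr_ge0.
Qed.

Lemma tnormD x y : tnorm (tadd x y) <= tnorm x + tnorm y.
Proof.
rewrite tnorm_le ?addr_ge0 ?tnorm_ge0//.
rewrite !tdotE sqrrD !tnorm_sqr (tdotC y x).
have := tdot_le_tnorm x y; lra.
Qed.

Lemma tnormN x y : tnorm (tsub x y) = tnorm (tsub y x).
Proof. by apply: tnorm_eq; rewrite !tdotE; ring. Qed.

Lemma tsub0 x : tsub x origin = x.
Proof. by apply: eq_from_tnth => i; rewrite !tnthE subr0. Qed.

Lemma cball0E (r : R) : @cball R n origin r = [set x | tnorm x <= r].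
Proof. by apply/seteqP; split => x /=; rewrite /cball/= tsub0. Qed.

Lemma ler_tnth_tnorm x i : `|tnth x i| <= tnorm x.
Proof.
rewrite -(@ler_pXn2r _ 2) ?nnegrE ?tnorm_ge0// tnorm_sqr -normrX.
rewrite ger0_norm ?sqr_ge0// /tdot (bigD1 i)//= -expr2 lerDl.
by apply: sumr_ge0 => j _; rewrite -expr2 sqr_ge0.
Qed.

Lemma tnorm_le_bound x (c : R) : 0 <= c -> (forall i, `|tnth x i| <= c) ->
  tnorm x <= n%:R * c.
Proof.
move=> c0 xc; rewrite tnorm_le ?mulr_ge0//.
apply: (@le_trans _ _ (\sum_(i < n) c ^+ 2)).
  apply: ler_sum => i _.
  by rewrite -expr2 -real_normK ?num_real// ler_pXn2r ?nnegrE.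
rewrite sumr_const card_ord -(mulr_natl (c ^+ 2)) exprMn ler_wpM2r ?sqr_ge0//.
by case: (n) => [|m]; rewrite ?expr2 ?mulr0// ler_peMr// ler1n.
Qed.

Lemma tnorm_e1x (r : R) : (0 < n)%N -> 0 <= r -> tnorm (@e1x R n r) = r.
Proof.
move=> n0 r0; rewrite -[RHS]ger0_norm// -sqrtr_sqr; congr Num.sqrt.
rewrite (bigD1 (Ordinal n0))//= tnth_mktuple/= big1 ?addr0// => i i0.
by rewrite tnth_mktuple ifF ?expr0n//; apply: contraNF i0 => /eqP i0; apply/eqP/val_inj.
Qed.

Lemma measurable_tadd : measurable_fun setT (fun z : n.-tuple R * n.-tuple R => tadd z.1 z.2).
Proof.
apply/measurable_fun_tnthP => i.
rewrite (_ : _ \o _ = fun z : n.-tuple R * n.-tuple R => tnth z.1 i + tnth z.2 i); last first.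
  by apply/funext => z /=; rewrite tnthE.
apply: measurable_funD.
  exact: (measurableT_comp (measurable_tnth i) measurable_fst).
exact: (measurableT_comp (measurable_tnth i) measurable_snd).
Qed.

Lemma measurable_tsub : measurable_fun setT (fun z : n.-tuple R * n.-tuple R => tsub z.1 z.2).
Proof.
apply/measurable_fun_tnthP => i.
rewrite (_ : _ \o _ = fun z : n.-tuple R * n.-tuple R => tnth z.1 i - tnth z.2 i); last first.
  by apply/funext => z /=; rewrite tnthE.
apply: measurable_funB.
  exact: (measurableT_comp (measurable_tnth i) measurable_fst).
exact: (measurableT_comp (measurable_tnth i) measurable_snd).
Qed.

Lemma measurable_tscale c : measurable_fun setT (@tscale c).
Proof.
apply/measurable_fun_tnthP => i.
rewrite (_ : _ \o _ = fun z : n.-tuple R => c * tnth z i); last first.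
  by apply/funext => z /=; rewrite tnthE.
by apply: measurable_funM => //; exact: measurable_tnth.
Qed.

Lemma measurable_tdot x : measurable_fun setT (tdot x).
Proof.
apply: measurable_sum => i.
by apply: measurable_funM => //; exact: measurable_tnth.
Qed.

Lemma measurable_tnorm : measurable_fun setT (@tnorm R n).
Proof.
apply: measurableT_comp.
  exact: continuous_measurable_fun (@sqrt_continuous R).
apply: measurable_sum => i.
by apply: measurable_funX; exact: measurable_tnth.
Qed.

Lemma measurable_cball x (r : R) : measurable (cball x r).
Proof.
have mf : measurable_fun setT (fun y => tnorm (tsub y x)).
  apply: (measurableT_comp measurable_tnorm).
  exact: (measurableT_comp measurable_tsub
    (measurable_fun_pair (@measurable_id _ _ _) (@measurable_cst _ _ _ _ _ x))).
have := mf measurableT _ (measurable_itv `]-oo, r]).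
by rewrite setTI; congr measurable; apply/seteqP; split => y; rewrite /cball/= in_itv.
Qed.

Lemma boxE (a b : n.-tuple R) :
  box a b = \bigcap_(i in [set: 'I_n]) (fun x => tnth x i) @^-1` `[tnth a i, tnth b i].
Proof.
apply/seteqP; split => x /= h i; first by move=> _ /=; rewrite in_itv/=.
by have := h i I; rewrite /= in_itv.
Qed.

Lemma measurable_box (a b : n.-tuple R) : measurable (box a b).
Proof.
rewrite boxE; apply: fin_bigcap_measurable => // i _.
rewrite -[X in measurable X]setTI; exact: measurable_tnth.
Qed.

End EuclideanSpace.

(** * Uniqueness, scaling and translation of Lebesgue measure *)

Section Lebesgue.
Context {R : realType} {n : nat} (mu : {measure set (n.-tuple R) -> \bar R}).
Context (mu_leb : is_lebesgue_n mu).
Implicit Types x y z : n.-tuple R.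

Lemma box_set0 (a b : n.-tuple R) i : tnth b i < tnth a i -> box a b = set0.
Proof.
move=> ba; rewrite -subset0 => x /(_ i) /andP[h1 h2].
by have := le_lt_trans (le_trans h1 h2) ba; rewrite ltxx.
Qed.

Definition cube (k : R) : set (n.-tuple R) := box [tuple - k | i < n] [tuple k | i < n].

Lemma cubeE k : cube k = [set x | forall i, `|tnth x i| <= k].
Proof. by apply/seteqP; split => x /= h i; have := h i; rewrite !tnth_mktuple ler_norml. Qed.

Lemma bigcup_cube : \bigcup_k (cube k%:R) = setT.
Proof.
apply/seteqP; split => // x _; exists (Num.truncn (tnorm x)).+1 => //.
rewrite cubeE => i; apply: (le_trans (ler_tnth_tnorm x i)).
by apply: ltW; apply: truncnS_gt.
Qed.

Lemma lebesgue_cube_lty k : (mu (cube k) < +oo)%E.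
Proof.
have [k0|k0] := leP 0 k.
  rewrite mu_leb ?ltry// => i.
  by rewrite !tnth_mktuple; lra.
case: (posnP n) => [n0|n0].
  rewrite mu_leb ?ltry// => i.
  by move: (ltn_ord i); rewrite [X in (_ < X)%N]n0.
rewrite /cube (@box_set0 _ _ (Ordinal n0)) ?measure0 ?ltry//.
by rewrite !tnth_mktuple; lra.
Qed.

Lemma sigma_finite_lebesgue : sigma_finite setT mu.
Proof.
exists (fun k => cube k%:R); first by rewrite bigcup_cube.
by move=> k; split; [exact: measurable_box|exact: lebesgue_cube_lty].
Qed.

Lemma measurable_boxes : @measurable _ (n.-tuple R) =
  <<s [set B | exists a b, B = box a b] >>.
Proof.
apply/seteqP; split; last first.
  apply: smallest_sub; first exact: sigma_algebra_measurable.
  by move=> _ [a [b ->]]; exact: measurable_box.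
apply: smallest_sub; first exact: smallest_sigma_algebra.
rewrite -bigcup_seq => A [i /= _ [B mB <-]]; rewrite setTI.
pose S := <<s [set B | exists a b, B = @box R n a b] >>.
pose tx := g_sigma_algebraType [set B | exists a b, B = @box R n a b].
suff : measurable_fun setT ((fun x => tnth x i) : tx -> R).
  by move=> /(_ measurableT _ mB); rewrite setTI.
apply: (@measurability _ _ tx R _ _ _ (RGenCInfty.measurableE R)).
move=> _ [_ [a ->] <-]; rewrite setTI.
(* The half-space x_i >= a is the union over k of the boxes with side [a, k] in direction i and
   [-k, k] in the others. *)
rewrite (_ : _ @^-1` _ = \bigcup_k box [tuple if j == i then a else - k%:R | j < n]
    [tuple k%:R | j < n]).
  apply: (@bigcupT_measurable _ tx) => k; apply: sub_sigma_algebra.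
  by eexists; eexists.
apply/seteqP; split => x /=.
  rewrite in_itv/= andbT => ax; exists (Num.truncn (tnorm x)).+1 => // j.
  have : `|tnth x j| <= (Num.truncn (tnorm x)).+1%:R.
    apply: (le_trans (ler_tnth_tnorm x j)).
    by apply: ltW; apply: truncnS_gt.
  rewrite ler_norml => /andP[h1 h2].
  by rewrite !tnth_mktuple h2 andbT; case: eqVneq => // ->.
by move=> [k _ /(_ i)]; rewrite !tnth_mktuple eqxx in_itv/= andbT => /andP[].
Qed.

Lemma lebesgue_unique (m : {measure set (n.-tuple R) -> \bar R}) :
  (forall a b : n.-tuple R, (forall i, tnth a i <= tnth b i) ->
    m (box a b) = (\prod_(i < n) (tnth b i - tnth a i))%:E) ->
  forall A, measurable A -> m A = mu A.
Proof.
move=> mbox A mA; apply/esym.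
have H := @measure_unique _ R _ _ (fun k => cube k%:R) measurable_boxes.
apply: H => //.
- move=> _ _ [a [b ->]] [a' [b' ->]].
  exists [tuple Num.max (tnth a i) (tnth a' i) | i < n],
    [tuple Num.min (tnth b i) (tnth b' i) | i < n].
  apply/seteqP; split => x /=.
    move=> [h h'] i; rewrite !tnth_mktuple ge_max le_min.
    move/andP: (h i) => [h1 h2]; move/andP: (h' i) => [h3 h4].
    by rewrite h1 h2 h3 h4.
  move=> h; split => i; have := h i; rewrite !tnth_mktuple ge_max le_min;
    by move=> /andP[/andP[h1 h2] /andP[h3 h4]]; apply/andP.
- by move=> k; eexists; eexists.
- exact: bigcup_cube.
- move=> _ [a [b ->]].
  (* The volume is prescribed for ordered endpoints only; a box with a reversed side, such as an
     intersection of boxes may produce, is empty. *)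
  have [ab|] := pselect (forall i, tnth a i <= tnth b i); first by rewrite mu_leb// mbox.
  move=> /existsNP[i /negP]; rewrite -ltNge => ba.
  by rewrite (box_set0 _ _ _ ba) !measure0.
- by move=> k; exact: lebesgue_cube_lty.
Qed.

Lemma measurable_affine x (c : R) : measurable_fun setT (fun y => tadd x (tscale c y)).
Proof.
exact: (measurableT_comp measurable_tadd
  (measurable_fun_pair (@measurable_cst _ _ _ _ _ x) (measurable_tscale c))).
Qed.

(** The image of [mu] under y -> x + c y, multiplied by c^n, gives every box its volume, so
    uniqueness applies. *)
Lemma lebesgue_affine x (c : R) A : 0 < c -> measurable A ->
  ((c ^+ n)%:E * mu ((fun y => tadd x (tscale c y)) @^-1` A) = mu A)%E.
Proof.
move=> c0 mA; have cn0 : 0 <= c ^+ n by rewrite exprn_ge0// ltW.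
pose phi : {mfun _ >-> _} := HB.pack (fun y => tadd x (tscale c y))
  (isMeasurableFun.Build _ _ _ _ _ (measurable_affine x c)).
apply: (lebesgue_unique (mscale (NngNum cn0) (pushforward mu phi)) _ A mA).
move=> a b ab.
rewrite [LHS](_ : _ = ((c ^+ n)%:E * mu ((fun y => tadd x (tscale c y)) @^-1` box a b))%E)//.
rewrite (_ : (fun y => _) @^-1` _ = box [tuple (tnth a i - tnth x i) / c | i < n]
    [tuple (tnth b i - tnth x i) / c | i < n]); last first.
  apply/seteqP; split => y /= h i; have := h i; rewrite !tnthE !tnth_mktuple.
    by rewrite ler_pdivrMr// ler_pdivlMr// lerBlDl lerBrDl (mulrC c).
  by rewrite ler_pdivrMr// ler_pdivlMr// lerBlDl lerBrDl (mulrC c).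
rewrite mu_leb => [|i]; last by rewrite !tnth_mktuple ler_pM2r ?invr_gt0// lerB.
have -> : c ^+ n = \prod_(i < n) c by rewrite prodr_const card_ord.
rewrite -EFinM -big_split/=; congr EFin.
apply: eq_bigr => i _; rewrite !tnth_mktuple.
by field; rewrite gt_eqF.
Qed.

Lemma lebesgue_tadd x A : measurable A -> mu (tadd x @^-1` A) = mu A.
Proof.
move=> mA; rewrite -[RHS](@lebesgue_affine x 1)// expr1n mul1e; congr (mu (_ @^-1` A)).
by apply/funext => y; apply: eq_from_tnth => i; rewrite !tnthE mul1r.
Qed.

Lemma cball_lebesgue_lty x r : (mu (cball x r) < +oo)%E.
Proof.
apply: le_lt_trans (lebesgue_cube_lty (r + tnorm x)).
apply: le_measure; rewrite ?inE; [exact: measurable_cball|exact: measurable_box|].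
rewrite cubeE => y; rewrite /cball/= => yr i.
rewrite -[tnth y i](subrK (tnth x i)); apply: (le_trans (ler_normD _ _)).
rewrite lerD ?ler_tnth_tnorm// (le_trans _ yr)// -tnth_tsub.
exact: ler_tnth_tnorm.
Qed.

Lemma cball_lebesgue_fin_num x r : mu (cball x r) \is a fin_num.
Proof. by rewrite ge0_fin_numE ?cball_lebesgue_lty// measure_ge0. Qed.

Lemma vball_ge0 : 0 <= vball mu.
Proof. exact/fine_ge0/measure_ge0. Qed.

Lemma vball_gt0 : (0 < n)%N -> 0 < vball mu.
Proof.
move=> n0; rewrite /vball fine_gt0// cball_lebesgue_lty andbT.
(* The cube of half-side 1/n lies in the unit ball by the crude bound |x| <= n max |x_i|. *)
apply: (@lt_le_trans _ _ (mu (cube n%:R^-1))).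
  rewrite mu_leb; last first.
    by move=> i; rewrite !tnth_mktuple ge0_cp// invr_ge0.
  rewrite lte_fin; apply: prodr_gt0 => i _; rewrite !tnth_mktuple.
  by rewrite opprK addr_gt0// invr_gt0 ltr0n.
apply: le_measure; rewrite ?inE; [exact: measurable_box|exact: measurable_cball|].
rewrite cubeE cball0E => x/= /tnorm_le_bound; rewrite invr_ge0 ler0n => /(_ isT).
by rewrite mulfV// pnatr_eq0 -lt0n.
Qed.

Lemma lebesgue_cball0 r : (0 < n)%N -> 0 <= r ->
  mu (cball origin r) = (vball mu * r ^+ n)%:E.
Proof.
(* Scaling requires a positive factor; the ball of radius 0 is the degenerate box at the origin, of
   volume 0 because n > 0. *)
move=> n0; rewrite le_eqVlt => /predU1P[<-|r0].
  rewrite expr0n gtn_eqF// mulr0.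
  rewrite (_ : cball _ _ = box origin origin).
    rewrite mu_leb// (bigD1 (Ordinal n0))//=.
    by rewrite subrr mul0r.
  rewrite cball0E; apply/seteqP; split => x /= h.
    move=> i; rewrite tnthE -eq_le eq_sym -normr_le0.
    exact: (le_trans (ler_tnth_tnorm x i)).
  have {}h i : `|tnth x i| <= 0 by rewrite normr_le0 eq_sym eq_le; have := h i; rewrite tnthE.
  by rewrite (le_trans (@tnorm_le_bound _ _ _ 0 _ h))// mulr0.
rewrite -(@lebesgue_affine origin r)//; last exact: measurable_cball.
rewrite mulrC EFinM fineK ?cball_lebesgue_fin_num//; congr (_ * mu _)%E.
have nE x : tnorm (tadd origin (tscale r x)) = r * tnorm x.
  rewrite (_ : tadd _ _ = tscale r x).
    apply/eqP; rewrite -(@eqrXn2 _ 2) ?mulr_ge0 ?tnorm_ge0 ?ltW//.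
    by rewrite exprMn !tnorm_sqr !tdotE mulrA -expr2.
  by apply: eq_from_tnth => i; rewrite !tnthE add0r.
rewrite !cball0E; apply/seteqP; split => x; rewrite /preimage/mkset nE.
  by rewrite -[X in _ <= X]mulr1 ler_pM2l.
by rewrite -[X in _ -> _ <= X]mulr1 ler_pM2l.
Qed.

End Lebesgue.

Lemma measurable_preimage d1 d2 (T1 : measurableType d1) (T2 : measurableType d2)
  (f : T1 -> T2) A : measurable_fun setT f -> measurable A -> measurable (f @^-1` A).
Proof. by move=> mf mA; rewrite -[X in measurable X]setTI; exact: mf. Qed.

Section SigmaFinite.
Context d (T : measurableType d) (R : realType) (m : {measure set T -> \bar R}).

(** A copy of [m] indexed by a proof of sigma-finiteness, so that the structure can be attached to a
    measure known to be sigma-finite only by hypothesis. *)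
Definition sigma_finite_pack (_ : sigma_finite setT m) : set T -> \bar R := m.

Context (msf : sigma_finite setT m).

HB.instance Definition _ := Measure.on (sigma_finite_pack msf).

Let sigma_finite_packT : sigma_finite setT (sigma_finite_pack msf).
Proof. exact: msf. Qed.

HB.instance Definition _ :=
  Measure_isSigmaFinite.Build _ _ _ (sigma_finite_pack msf) sigma_finite_packT.

End SigmaFinite.

(** Both sides are values at [S] of product measures, and these coincide because they agree on
    rectangles. *)
Lemma integral_xsection_ysection d1 d2 (T1 : measurableType d1) (T2 : measurableType d2)
  (R : realType) (m1 : {measure set T1 -> \bar R}) (m2 : {measure set T2 -> \bar R})
  (S : set (T1 * T2)) : sigma_finite setT m1 -> sigma_finite setT m2 -> measurable S ->
  (\int[m1]_x m2 (xsection S x) = \int[m2]_y m1 (ysection S y))%E.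
Proof.
move=> s1 s2 mS.
pose M1 : {sigma_finite_measure set T1 -> \bar R} := sigma_finite_pack _ _ _ m1 s1.
pose M2 : {sigma_finite_measure set T2 -> \bar R} := sigma_finite_pack _ _ _ m2 s2.
have : ((M1 \x M2) S = (M1 \x^ M2) S)%E.
  by apply: product_measure_unique => // A B mA mB; exact: product_measure2E.
exact.
Qed.

Lemma measurable_measure_xsection d1 d2 (T1 : measurableType d1) (T2 : measurableType d2)
  (R : realType) (m2 : {measure set T2 -> \bar R}) (S : set (T1 * T2)) :
  sigma_finite setT m2 -> measurable S ->
  measurable_fun setT (fun x => m2 (xsection S x)).
Proof. by move=> s2 mS; exact: (measurable_fun_xsection (sigma_finite_pack _ _ _ m2 s2)). Qed.

(** * Invariance under reflections and the volume of a lens *)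

Section Isometry.
Context {R : realType} {n : nat} (mu : {measure set (n.-tuple R) -> \bar R}).
Context (mu_leb : is_lebesgue_n mu) (n_gt0 : (0 < n)%N).
Implicit Types x y z : n.-tuple R.

(* Integrate 1_A(x) 1_B(x + z) against mu(dx) nu(dz), A being the unit ball, in both orders:
   translation invariance gives mu(A) nu(B) = mu(B) nu(- A), and - A = A. *)
Lemma translation_invariant_eq (nu : {measure set (n.-tuple R) -> \bar R}) :
  sigma_finite setT nu ->
  (forall x A, measurable A -> nu (tadd x @^-1` A) = nu A) ->
  nu (cball origin 1) = mu (cball origin 1) ->
  forall A, measurable A -> nu A = mu A.
Proof.
move=> nu_sf nu_inv nu1 B mB; set A := cball origin 1 in nu1.
have mA : measurable A by exact: measurable_cball.
pose S1 := [set z : n.-tuple R * n.-tuple R | A z.1 /\ B (tadd z.1 z.2)].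
pose S2 := [set z : n.-tuple R * n.-tuple R | B z.1 /\ A (tsub z.1 z.2)].
have mS1 : measurable S1.
  apply: measurableI; first exact: measurable_preimage measurable_fst mA.
  exact: measurable_preimage measurable_tadd mB.
have mS2 : measurable S2.
  apply: measurableI; first exact: measurable_preimage measurable_fst mB.
  exact: measurable_preimage measurable_tsub mA.
have int_section (C D : set (n.-tuple R)) : measurable C -> measurable D ->
    (\int[mu]_x (nu D * (\1_C x)%:E) = mu C * nu D)%E.
  move=> mC mD; rewrite ge0_integralZl//; last first.
    by apply/measurable_EFinP; exact: measurable_indic.
  by rewrite integral_indic// setIT muleC.
have I1 : (\int[mu]_x nu (xsection S1 x) = mu A * nu B)%E.
  rewrite -int_section//; apply: eq_integral => x _; rewrite indicE.
  have [Ax|Ax] := pselect (A x).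
    rewrite mem_set// mule1 -(nu_inv x B)//; congr (nu _).
    apply/seteqP; split => y; rewrite /xsection/= inE/=; first by case.
    by [].
  rewrite memNset// mule0 (_ : xsection _ _ = set0) ?measure0//.
  by rewrite -subset0 => y; rewrite /xsection/= inE/= => -[].
have I2 : (\int[mu]_x nu (xsection S2 x) = mu B * nu A)%E.
  rewrite -int_section//; apply: eq_integral => x _; rewrite indicE.
  have [Bx|Bx] := pselect (B x).
    rewrite mem_set// mule1 -(nu_inv (tscale (-1) x) A)//; congr (nu _).
    have E y : tnorm (tsub x y) = tnorm (tadd (tscale (-1) x) y).
      by apply: tnorm_eq; rewrite !tdotE; ring.
    rewrite /A cball0E; apply/seteqP; split => y; rewrite /xsection/= inE /S2/= /A cball0E/= E.
      by case.
    by [].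
  rewrite memNset// mule0 (_ : xsection _ _ = set0) ?measure0//.
  by rewrite -subset0 => y; rewrite /xsection/= inE/= => -[].
(* The y-section of [S1] is the preimage under translation by y of the y-section of [S2]. *)
have E12 : (\int[mu]_x nu (xsection S1 x) = \int[mu]_x nu (xsection S2 x))%E.
  have mu_sf := sigma_finite_lebesgue mu mu_leb.
  rewrite !integral_xsection_ysection//; apply: eq_integral => y _.
  rewrite -[RHS](lebesgue_tadd mu mu_leb y); last exact: measurable_ysection.
  congr (mu _); apply/seteqP; split => x; rewrite /ysection/= !inE/=.
    move=> [h1 h2]; split => /=; last first.
      by rewrite (_ : tsub _ _ = x)//; apply: eq_from_tnth => i; rewrite !tnthE; ring.
    by rewrite (_ : tadd y x = tadd x y)//; apply: eq_from_tnth => i; rewrite !tnthE; ring.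
  rewrite /S2/= (_ : tadd y x = tadd x y); last first.
    by apply: eq_from_tnth => i; rewrite !tnthE; ring.
  rewrite (_ : tsub _ _ = x); first by case.
  by apply: eq_from_tnth => i; rewrite !tnthE; ring.
move: E12; rewrite I1 I2 nu1 muleC.
have vA : mu A = (vball mu)%:E by rewrite fineK// cball_lebesgue_fin_num.
move/(congr1 (fun e => e * ((vball mu)^-1)%:E)%E).
by rewrite -!muleA vA -EFinM mulfV ?mule1// gt_eqF// vball_gt0.
Qed.

(** The image of [mu] under [T] is again translation invariant, a translation by [x] becoming one by
    [T x], and it gives the unit ball the same mass because [T] preserves norms. *)
Lemma lebesgue_isometry (T : n.-tuple R -> n.-tuple R) : measurable_fun setT T ->
  involutive T -> {morph T : x y / tadd x y} -> (forall x, tnorm (T x) = tnorm x) ->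
  forall A, measurable A -> mu (T @^-1` A) = mu A.
Proof.
move=> mT invT addT normT A mA.
pose phi : {mfun _ >-> _} := HB.pack T (isMeasurableFun.Build _ _ _ _ _ mT).
have TB (r : R) : T @^-1` cball origin r = cball origin r.
  by rewrite cball0E; apply/funext => x /=; rewrite normT.
apply: (translation_invariant_eq (pushforward mu phi) _ _ _ A mA).
- exists (fun k => cball origin k%:R).
    apply/seteqP; split => // x _; exists (Num.truncn (tnorm x)).+1 => //.
    by rewrite cball0E/=; apply/ltW/truncnS_gt.
  move=> k; split; first exact: measurable_cball.
  change (mu (T @^-1` cball origin k%:R) < +oo)%E.
  by rewrite TB cball_lebesgue_lty.
- move=> x B mB; change (mu (T @^-1` (tadd x @^-1` B)) = mu (T @^-1` B)).
  rewrite -[RHS](lebesgue_tadd mu mu_leb (T x)); last exact: measurable_preimage.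
  congr (mu _); apply/funext => y /=.
  by rewrite addT invT.
- by change (mu (T @^-1` cball origin 1) = mu (cball origin 1)); rewrite TB.
Qed.

Definition householder u y := tsub y (tscale (2 * tdot u y / tdot u u) u).

Lemma lebesgue_householder u A : tdot u u != 0 -> measurable A ->
  mu (householder u @^-1` A) = mu A.
Proof.
move=> u0; apply: lebesgue_isometry.
- apply/measurable_fun_tnthP => i.
  rewrite (_ : _ \o _ = fun y => tnth y i - 2 * tdot u y / tdot u u * tnth u i).
    apply: measurable_funB; first exact: measurable_tnth.
    apply: measurable_funM => //; apply: measurable_funM => //; apply: measurable_funM => //.
    exact: measurable_tdot.
  by apply/funext => y /=; rewrite !tnthE.
- move=> y; apply: eq_from_tnth => i.
  rewrite /householder !tnthE !tdotE.
  by field.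
- move=> x y; apply: eq_from_tnth => i.
  rewrite /householder !tnthE !tdotE.
  by field.
- move=> x; apply: tnorm_eq; rewrite /householder !tdotE (tdotC x u).
  by field.
Qed.

(** [Avol] places the second centre on the first axis. The reflection in the hyperplane bisecting
    [x] and that point exchanges the two and fixes the ball at the origin. *)
Lemma cballI_Avol (r s : R) x : mu (cball origin r `&` cball x s) = (Avol mu r s (tnorm x))%:E.
Proof.
have mI y : measurable (cball origin r `&` cball y s).
  by apply: measurableI; exact: measurable_cball.
have E : mu (cball origin r `&` cball x s) = mu (cball origin r `&` cball (e1x (tnorm x)) s).
  set e := e1x _.
  have xe : tdot x x = tdot e e.
    by rewrite -!tnorm_sqr tnorm_e1x// tnorm_ge0.
  have [u uE] : exists u, u = tsub x e by eexists.
  (* Equal norms of [x] and [e] make the reflection coefficient 2 (u.x) / (u.u) equal to 1, so [x]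
     is sent to x - u = e. *)
  have uuE : tdot u u = 2 * tdot u x by rewrite uE !tdotE (tdotC e x) -xe; ring.
  have [u0|u0] := eqVneq (tdot u u) 0.
    suff -> : x = e by [].
    apply: eq_from_tnth => i; apply/eqP; rewrite -subr_eq0 -tnth_tsub -uE -normr_le0.
    by apply: (le_trans (ler_tnth_tnorm _ i)); rewrite tnorm_le// u0 expr0n.
  rewrite -[LHS](lebesgue_householder u)//; congr (mu _).
  have hn y : tnorm (householder u y) = tnorm y.
    apply: tnorm_eq; rewrite /householder !tdotE (tdotC y u).
    by field.
  have hx : householder u x = e.
    apply: eq_from_tnth => i; rewrite /householder !tnthE -uuE divff// mul1r uE tnthE.
    ring.
  have hd y : tnorm (tsub (householder u y) x) = tnorm (tsub y e).
    rewrite -[RHS]hn; apply: tnorm_eq.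
    suff -> : tsub (householder u y) x = householder u (tsub y e) by [].
    have [f fE] : exists f, f = e by eexists.
    have hf : x = householder u f.
      have ue : tdot u f = - tdot u x.
        by rewrite fE -hx /householder !tdotE; field.
      apply: eq_from_tnth => i; rewrite /householder !tnthE ue mulrN mulNr mulNr -uuE.
      by rewrite divff// mul1r uE tnthE fE; ring.
    rewrite -fE; apply: eq_from_tnth => i; rewrite {1}hf /householder !tnthE !tdotE.
    by field.
  rewrite !cball0E; apply/seteqP; split => y; rewrite /cball/= hn hd; done.
rewrite E fineK// ge0_fin_numE ?measure_ge0//.
apply: le_lt_trans (cball_lebesgue_lty mu mu_leb origin r).
by apply: le_measure; rewrite ?inE//; exact: measurable_cball.
Qed.

End Isometry.

(** * Polar coordinates *)

Section Density.
Context d (T : measurableType d) (R : realType) (m : {measure set T -> \bar R}).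
Context (g : T -> R) (mg : measurable_fun setT g) (g0 : forall x, 0 <= g x).

(** The proofs about [g] are arguments so that the measure structure can be found from the term
    alone. *)
Definition density_measure (_ : measurable_fun setT g) (_ : forall x, 0 <= g x) (A : set T) :=
  (\int[m]_(x in A) (g x)%:E)%E.

Local Notation dens := (density_measure mg g0).

Let density0 : dens set0 = 0%E.
Proof. by rewrite /density_measure integral_set0. Qed.

Let density_ge0 A : (0 <= dens A)%E.
Proof. by apply: integral_ge0 => x _; rewrite lee_fin. Qed.

Let density_sigma_additive : semi_sigma_additive dens.
Proof.
move=> /= F mF tF mUF; rewrite /density_measure; apply: cvg_toP.
  apply: ereal_nondecreasing_is_cvgn => i j ij.
  by apply: lee_sum_nneg_natr => // k _ _; apply: integral_ge0 => x _; rewrite lee_fin.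
rewrite ge0_integral_bigcup//=.
- by apply/measurable_funTS/measurable_EFinP.
- by move=> x _; rewrite lee_fin.
Qed.

HB.instance Definition _ := isMeasure.Build _ _ _ dens
  density0 density_ge0 density_sigma_additive.

Import HBNNSimple.

(** On indicators this is the definition of the measure; simple functions follow by linearity over
    their level sets, and the general case by monotone convergence on both sides. *)
Lemma ge0_integral_density (h : T -> \bar R) : measurable_fun setT h ->
  (forall x, 0 <= h x)%E ->
  (\int[dens]_x h x = \int[m]_x (h x * (g x)%:E))%E.
Proof.
move=> mh h0; pose f := nnsfun_approx measurableT mh.
have mf k : measurable_fun setT (fun x => (f k x)%:E) by exact/measurable_EFinP.
have mfg k : measurable_fun setT (fun x => (f k x)%:E * (g x)%:E)%E.
  by apply: emeasurable_funM => //; exact/measurable_EFinP.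
have cvgf x : (f k x)%:E @[k --> \oo] --> h x.
  exact: (@cvg_nnsfun_approx _ _ _ _ measurableT _ mh (fun x _ => h0 x)).
have ndf x : {homo (fun k => (f k x)%:E) : i j / (i <= j)%N >-> (i <= j)%E}.
  by move=> i j ij; rewrite lee_fin; exact/lefP/nd_nnsfun_approx.
transitivity (limn (fun k => \int[dens]_x (f k x)%:E))%E.
  rewrite -monotone_convergence//; last by move=> k x _; rewrite lee_fin.
  by apply: eq_integral => x _; apply/esym/cvg_lim.
transitivity (limn (fun k => \int[m]_x ((f k x)%:E * (g x)%:E)))%E; last first.
  rewrite -monotone_convergence//; last 2 first.
  - by move=> k x _; rewrite mule_ge0// lee_fin.
  - by move=> x _ i j ij; rewrite lee_wpmul2r ?lee_fin// -lee_fin ndf.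
  apply: eq_integral => x _; apply/cvg_lim => //.
  by apply: cvgeZr.
congr (limn _); apply/funext => k.
transitivity (\int[dens]_x
   (\sum_(y \in range (f k)) (y * \1_(f k @^-1` [set y]) x)%:E))%E.
  by apply: eq_integral => t _; rewrite /= fimfunE -fsumEFin.
have indich r : measurable_fun setT (fun x => (r * \1_(f k @^-1` [set r]) x)%:E).
  by apply/measurable_EFinP; exact: measurable_funM.
rewrite ge0_integral_fsum//; last by move=> y x _; exact: nnfun_muleindic_ge0.
transitivity (\int[m]_x (\sum_(y \in range (f k))
    (y * \1_(f k @^-1` [set y]) x)%:E * (g x)%:E))%E; last first.
  apply: eq_integral => x _.
  rewrite -ge0_mule_fsuml => [|y]; last exact: nnfun_muleindic_ge0.
  by rewrite fsumEFin // -(fimfunE _ x).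
rewrite ge0_integral_fsum//; last 2 first.
  - by move=> y; apply: emeasurable_funM => //; exact/measurable_EFinP.
  - by move=> r y _; apply: mule_ge0; [exact: nnfun_muleindic_ge0|rewrite lee_fin].
apply: eq_fsbigr => r rhn.
under [LHS]eq_integral do rewrite EFinM.
rewrite integralZl_indic_nnsfun => //.
rewrite integral_indic// setIT.
under [RHS]eq_integral do rewrite EFinM -muleA.
rewrite ge0_integralZl//.
- congr (_ * _)%E.
  transitivity (\int[m]_(x in f k @^-1` [set r]) (g x)%:E)%E => //.
  rewrite integral_mkcond.
  by apply: eq_integral => x _; rewrite epatch_indic muleC.
- by apply: emeasurable_funM; exact/measurable_EFinP.
- by move=> t _; rewrite mule_ge0 ?lee_fin ?g0.
- by move: rhn; rewrite inE => -[t _ <-]; rewrite lee_fin.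
Qed.

End Density.

Section Polar.
Context {R : realType} {n : nat} (mu : {measure set (n.-tuple R) -> \bar R}).
Context (mu_leb : is_lebesgue_n mu) (n_gt0 : (0 < n)%N).

Lemma integral_monomial (a : R) : 0 <= a ->
  (\int[lebesgue_measure]_(x in `[0%R, a]) (n%:R * x ^+ n.-1)%:E = (a ^+ n)%:E)%E.
Proof.
rewrite le_eqVlt => /predU1P[<-|a0].
  by rewrite set_itv1 integral_set1 expr0n gtn_eqF.
rewrite (@continuous_FTC2 _ _ (fun x => x ^+ n)) ?expr0n ?gtn_eqF ?sube0//.
- by apply: continuous_subspaceT => x; apply: cvgM; [exact: cvg_cst|exact: exprn_continuous].
- split; first by move=> x _; exact: exprn_derivable.
    by apply: cvg_at_right_filter; exact: exprn_continuous.
  by apply: cvg_at_left_filter; exact: exprn_continuous.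
- by move=> x _; rewrite exp_derive1.
Qed.


(** Closed left rays are the convenient generators here: their preimages under the norm are balls
    around the origin or empty. *)
Lemma measurable_rays : @measurable _ (measurableTypeR R) =
  <<s [set B | exists a : R, B = `]-oo, a]%classic] >>.
Proof.
apply/seteqP; split; last first.
  apply: smallest_sub; first exact: sigma_algebra_measurable.
  by move=> _ [a ->]; exact: measurable_itv.
rewrite [X in X `<=` _](RGenOInfty.measurableE R).
apply: smallest_sub; first exact: smallest_sigma_algebra.
move=> _ [a ->]; rewrite -setCitvl.
apply: (@measurableC _ (g_sigma_algebraType [set B | exists a : R, B = `]-oo, a]%classic])).
by apply: sub_sigma_algebra; exists a.
Qed.

(* The maximum with 0 makes the density nonnegative on the whole line. *)
Definition radial_density (x : R) : R := Num.max 0 (vball mu * n%:R * x ^+ n.-1 * (0 <= x)%R%:R).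

Lemma radial_density_ge0 x : 0 <= radial_density x.
Proof. by rewrite /radial_density le_max lexx. Qed.

Lemma radial_densityE x : 0 <= x -> radial_density x = vball mu * (n%:R * x ^+ n.-1).
Proof.
move=> x0; rewrite /radial_density x0 mulr1 mulrA; apply/max_idPr.
by rewrite !mulr_ge0 ?vball_ge0// exprn_ge0.
Qed.

Lemma radial_density_lt0 x : x < 0 -> radial_density x = 0.
Proof. by move=> x0; rewrite /radial_density leNgt x0 mulr0 maxxx. Qed.

Lemma measurable_radial_density : measurable_fun setT radial_density.
Proof.
apply: measurable_maxr => //; apply: measurable_funM.
  by apply: measurable_funM => //; exact: exprn_measurable.
rewrite (_ : (fun x => _) = \1_(`[0, +oo[%classic : set R)); first exact: measurable_indic.
by apply/funext => x; rewrite indicE mem_setE in_itv/= andbT.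
Qed.

(** The image of [mu] under the norm and the measure of density [radial_density] agree on left rays,
    which are stable under intersection and exhaust the line with finite mass. *)
Lemma integral_tnorm (h : R -> \bar R) : measurable_fun setT h -> (forall x, 0 <= h x)%E ->
  (\int[mu]_x h (tnorm x) =
   \int[lebesgue_measure]_(x in `[0%R, +oo[) (h x * (vball mu * (n%:R * x ^+ n.-1))%:E))%E.
Proof.
move=> mh h0.
have mN : measurable_fun setT (@tnorm R n : n.-tuple R -> measurableTypeR R).
  exact: measurable_tnorm.
pose radial : {measure set (measurableTypeR R) -> \bar R} :=
  [the measure _ _ of pushforward mu (@tnorm R n : n.-tuple R -> measurableTypeR R)].
pose dens : {measure set (measurableTypeR R) -> \bar R} 
  := density_measure _ _ _ lebesgue_measure _ measurable_radial_density radial_density_ge0.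
transitivity (\int[radial mN]_x h x)%E.
  by rewrite [RHS]ge0_integral_pushforward//; exact: mN.
transitivity (\int[dens]_x h x)%E; last first.
  rewrite ge0_integral_density// [RHS]integral_mkcond; apply: eq_integral => x _.
  rewrite patchE mem_setE in_itv/= andbT; case: (leP 0 x) => x0.
    by rewrite radial_densityE.
  by rewrite radial_density_lt0// mule0.
apply: eq_measure_integral => A mA _.
(* For a >= 0 both sides are vn a^n, by the volume of a ball and by the primitive of n x^(n-1); for
   a < 0 both vanish. *)
have densE (a : R) : dens `]-oo, a]%classic = mu (tnorm @^-1` `]-oo, a]%classic).
  have [a0|a0] := leP 0 a.
    rewrite (_ : _ @^-1` _ = cball origin a); last first.
      by rewrite cball0E; apply/seteqP; split => x /=; rewrite in_itv.
    rewrite lebesgue_cball0// EFinM -integral_monomial//.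
    rewrite -ge0_integralZl//; last 3 first.
    - apply/measurable_EFinP; apply: measurable_funM => //; exact: exprn_measurable.
    - by move=> x /=; rewrite in_itv/= => /andP[x0 _]; rewrite lee_fin mulr_ge0// exprn_ge0.
    - by rewrite lee_fin vball_ge0.
    transitivity (\int[lebesgue_measure]_(x in `]-oo, a]%classic) (radial_density x)%:E)%E => //.
    rewrite [LHS]integral_mkcond [RHS]integral_mkcond.
    apply: eq_integral => x _; rewrite !patchE !mem_setE !in_itv/=.
    case: (leP 0 x) => x0 /=; first by case: ifP => // _; rewrite radial_densityE.
    by rewrite radial_density_lt0// if_same.
  rewrite (_ : _ @^-1` _ = set0) ?measure0; last first.
    rewrite -subset0 => x /=; rewrite in_itv/= => xa.
    by have := le_lt_trans xa a0; rewrite ltNge tnorm_ge0.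
  transitivity (\int[lebesgue_measure]_(x in `]-oo, a]%classic) (radial_density x)%:E)%E => //.
  rewrite integral0_eq// => x /=; rewrite in_itv/= => xa.
  by rewrite radial_density_lt0// (le_lt_trans xa).
have U := @measure_unique _ R _ _ 
  (fun k => `]-oo, (k%:R : R)]%classic : set (measurableTypeR R)) measurable_rays.
apply: (U _ _ _ (radial mN) dens) => //.
- move=> _ _ [a ->] [b ->]; exists (Num.min a b).
  by apply/seteqP; split => x /=; rewrite !in_itv/= le_min => /andP.
- by move=> k; eexists.
- apply/seteqP; split => // x _; exists (Num.truncn x).+1 => //=.
  by rewrite in_itv/=; apply/ltW/truncnS_gt.
- by move=> _ [a ->]; exact/esym/densE.
- move=> k; change (mu (tnorm @^-1` `]-oo, k%:R]%classic) < +oo)%E.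
  rewrite (_ : _ @^-1` _ = cball origin k%:R) ?cball_lebesgue_lty//.
  by rewrite cball0E; apply/seteqP; split => x /=; rewrite in_itv.
Qed.

End Polar.

(** * Void probabilities over a countable partition *)

Lemma measurable_fun_fibers {d1 d2} {T1 : measurableType d1} {T2 : measurableType d2}
  (kappa : T1 -> nat) (q : nat -> T2) : (forall j, measurable (kappa @^-1` [set j])) ->
  measurable_fun setT (fun x => q (kappa x)).
Proof.
move=> mk _ B _; rewrite setTI.
rewrite (_ : _ @^-1` B = \bigcup_(j in [set j | B (q j)]) kappa @^-1` [set j]).
  by apply: bigcup_measurable.
by apply/seteqP; split => [x Bx|x [j /= Bj]]; [exists (kappa x)|rewrite /preimage/= => ->].
Qed.

Lemma count_event0 {R : realType} {n : nat} {d} {Omega : measurableType d}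
  (Phi : Omega -> set (n.-tuple R)) B :
  count_event Phi B 0 = [set w | Phi w `&` B = set0].
Proof.
by apply/seteqP; split => w /=; rewrite /count_event/= II0 card_eq0 => /eqP.
Qed.

Lemma proba_count_event {R : realType} {n : nat} {d} {Omega : measurableType d}
  (P : probability Omega R) (mu : {measure set (n.-tuple R) -> \bar R}) lam W Phi B k :
  poisson_process P mu lam W Phi -> measurable B -> (mu (B `&` W) < +oo)%E ->
  P (count_event Phi B k) = (pois (lam * fine (mu (B `&` W))) k)%:E.
Proof.
move=> [_ PPhi] mB Blty.
have := PPhi 1%N (fun=> B) (fun=> k) (fun=> conj mB Blty).
rewrite big_ord1 (_ : \bigcap_(i in _) _ = count_event Phi B k).
  by apply=> i i' /negP[]; rewrite !ord1.
by rewrite bigcap_const//; exists ord0.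
Qed.

Section IndependentVoid.
Context {R : realType} {n : nat} {d : measure_display} {Omega : measurableType d}.
Context (P : probability Omega R) (mu : {measure set (n.-tuple R) -> \bar R}).
Context (lp ld rd : R) (X : nat -> Omega -> n.-tuple R) (D : nat -> Omega -> set (n.-tuple R)).
Context (mcpX : is_mcp P mu lp ld rd X D).
Context (ball_lty : (mu (cball origin rd) < +oo)%E).

(** The mass at 0 of the Poisson law of the number of daughters in [B], relative to their parent. *)
Definition void_proba (B : set (n.-tuple R)) : R :=
  expR (- (ld * fine (mu (B `&` cball origin rd)))).

Let ballI_lty (B : set (n.-tuple R)) : measurable B -> (mu (B `&` cball origin rd) < +oo)%E.
Proof.
move=> mB; apply: le_lt_trans ball_lty; apply: le_measure; rewrite ?inE//.
  by apply: measurableI => //; exact: measurable_cball.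
exact: measurable_cball.
Qed.

Lemma measurable_parent i (A : set (n.-tuple R)) : measurable A -> measurable (X i @^-1` A).
Proof. by case: mcpX => mX _ _ _ _ mA; exact: measurable_preimage. Qed.

Lemma measurable_daughter_count j B k : measurable B -> measurable (count_event (D j) B k).
Proof. by case: mcpX => _ _ _ /(_ j)[mD _] _; exact: mD. Qed.

Lemma daughter_void j B : measurable B -> P (count_event (D j) B 0) = (void_proba B)%:E.
Proof.
case: mcpX => _ _ _ /(_ j) PD _ mB.
rewrite (proba_count_event _ _ _ _ _ _ _ PD)// ?ballI_lty//.
by rewrite /pois expr0 fact0 divr1 mul1r.
Qed.

(** The first factor stays a joint probability: all [X i] share one class of the independence
    hypothesis, so nothing separates one parent from another. *)
Lemma parents_daughters_indep m (A B : nat -> set (n.-tuple R)) :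
  (forall i, measurable (A i)) -> (forall i, measurable (B i)) ->
  P ((\bigcap_(i in [set: 'I_m]) X i @^-1` A i) `&`
     (\bigcap_(i in [set: 'I_m]) count_event (D i) (B i) 0)) =
  (P (\bigcap_(i in [set: 'I_m]) X i @^-1` A i) * (\prod_(i < m) void_proba (B i))%:E)%E.
Proof.
move=> mA mB; case: (mcpX) => _ _ _ _ ind.
(* Index 0 stands for the parents and index k.+1 for the k-th daughter process. *)
pose J (i : 'I_m.+1) : option nat := if val i is k.+1 then Some k else None.
pose l (i : 'I_m.+1) : nat := if val i is _.+1 then 1%N else m.
pose E (i : 'I_m.+1) (j : 'I_(l i)) : set Omega :=
  if val i is k.+1 then count_event (D k) (B k) 0 else X j @^-1` A j.
have Jinj : injective J.
  by move=> [[|i] Hi] [[|j] Hj]//= => [_|[ij]]; apply: val_inj => //=; rewrite ij.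
have EG i j : match J i with
    | None => [set E | exists i A, measurable A /\ E = X i @^-1` A]
    | Some j => [set E | exists B k, measurable B /\ E = count_event (D j) B k] end (E i j).
  case: i j => [[|i] Hi] j /=; first by exists (val j), (A j).
  by exists (B i), 0%N.
have /= := ind m.+1 J Jinj l E EG.
rewrite big_ord_recl/=.
rewrite (_ : \bigcap_(i in _) \bigcap_(j in _) _ =
   (\bigcap_(i in [set: 'I_m]) X i @^-1` A i) `&`
     (\bigcap_(i in [set: 'I_m]) count_event (D i) (B i) 0)); last first.
  apply/seteqP; split => w.
    move=> H; split => i _; first by exact: (H ord0 I i I).
    exact: (H (lift ord0 i) I ord0 I).
  move=> [H1 H2] [[|i] Hi] _ j _; first exact: (H1 j I).
  exact: (H2 (Ordinal (Hi : (i < m)%N)) I).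
move=> ->; rewrite EFinM; congr (_ * _)%E.
  rewrite fineK//; apply: fin_num_measure; apply: fin_bigcap_measurable => // i _.
  exact: measurable_parent.
congr EFin; apply: eq_bigr => i _.
rewrite (_ : \bigcap_(j in _) _ = count_event (D i) (B i) 0).
  by rewrite daughter_void.
by rewrite /E/= bigcap_const//; exists ord0.
Qed.

(* The event that no daughter of a parent [X i], [i < m], lies in the set assigned to the cell
   [kappa (X i)] of that parent. *)
Definition no_hit (kappa : n.-tuple R -> nat) (S : nat -> set (n.-tuple R)) m : set Omega :=
  [set w | forall i, (i < m)%N -> D i w `&` S (kappa (X i w)) = set0].

Section Finite.
Context (kappa : n.-tuple R -> nat) (S : nat -> set (n.-tuple R)) (M : nat).
Context (mkappa : forall j, measurable (kappa @^-1` [set j])).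
Context (mS : forall j, measurable (S j)).
Context (kappaM : forall x, (kappa x <= M)%N).

Let q j := void_proba (S j).

(** [a] is read through [nth] so as to accept any natural index, as the families of
    [parents_daughters_indep] do. *)
Let cells m (a : {ffun 'I_m -> 'I_M.+1}) : set Omega :=
  \bigcap_(i in [set: 'I_m]) X i @^-1` (kappa @^-1` [set val (nth ord0 (fgraph a) i)]).
Let voids m (a : {ffun 'I_m -> 'I_M.+1}) : set Omega :=
  \bigcap_(i in [set: 'I_m]) count_event (D i) (S (nth ord0 (fgraph a) i)) 0.

Let nth_fgraph_ffun m (a : {ffun 'I_m -> 'I_M.+1}) (i : 'I_m) : nth ord0 (fgraph a) i = a i.
Proof. by rewrite nth_fgraph_ord. Qed.

Let cell_of m w : {ffun 'I_m -> 'I_M.+1} := [ffun i : 'I_m => inord (kappa (X i w))].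

Let cellsE m a w : cells m a w <-> a = cell_of m w.
Proof.
split=> [h|->].
  apply/ffunP => i; rewrite ffunE; apply: val_inj => /=.
  by rewrite inordK ?ltnS// (h i I) nth_fgraph_ffun.
by move=> i _ /=; rewrite nth_fgraph_ffun ffunE inordK ?ltnS.
Qed.

Let measurable_cells m a : measurable (cells m a).
Proof. by apply: fin_bigcap_measurable => // i _; exact: measurable_parent. Qed.

Let measurable_voids m a : measurable (voids m a).
Proof. by apply: fin_bigcap_measurable => // i _; exact: measurable_daughter_count. Qed.

Let sum_cells m (f : {ffun 'I_m -> 'I_M.+1} -> R) w :
  \sum_a f a * \1_(cells m a) w = f (cell_of m w).
Proof.
rewrite (bigD1 (cell_of m w))//= indicE mem_set ?mulr1; last exact/cellsE.
rewrite big1 ?addr0// => a aw; rewrite indicE memNset ?mulr0// => /cellsE aE.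
by rewrite aE eqxx in aw.
Qed.

(** On the event that fixes the cells of the first m parents, the random target sets become fixed
    ones, to which independence applies. *)
Lemma no_hit_bigcup m : no_hit kappa S m = \big[setU/set0]_a (cells m a `&` voids m a).
Proof.
rewrite -bigcup_seq; apply/seteqP; split => w.
  move=> H; exists (cell_of m w); first by rewrite /= mem_index_enum.
  split; first exact/cellsE.
  move=> i _; rewrite count_event0/= nth_fgraph_ffun ffunE inordK ?ltnS//.
  exact: H.
move=> [a _ [/cellsE aE aV] i im].
have := aV (Ordinal im) I.
by rewrite count_event0/= (nth_fgraph_ffun _ _ (Ordinal im)) aE ffunE inordK ?ltnS.
Qed.

Lemma measurable_no_hit_fin m : measurable (no_hit kappa S m).
Proof.
by rewrite no_hit_bigcup; apply: bigsetU_measurable => a _; exact: measurableI.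
Qed.

(** Each assignment of cells contributes the probability of that assignment times a product of void
    probabilities; exactly one assignment holds at each [w], so the sum is an expectation. *)
Lemma proba_no_hit m :
  P (no_hit kappa S m) = (\int[P]_w (\prod_(i < m) q (kappa (X i w)))%:E)%E.
Proof.
transitivity (\sum_a P (cells m a) * (\prod_(i < m) q (nth ord0 (fgraph a) i))%:E)%E.
  transitivity (\int[P]_w (\1_(no_hit kappa S m) w)%:E)%E.
    by rewrite integral_indic ?setIT//; exact: measurable_no_hit_fin.
  transitivity (\int[P]_w \sum_a (\1_(cells m a `&` voids m a) w)%:E)%E.
    apply: eq_integral => w _; rewrite sumEFin; congr EFin.
    have cv a : \1_(cells m a `&` voids m a) w = \1_(voids m a) w * \1_(cells m a) w :> R.
      by rewrite !indicE in_setI -natrM mulnb andbC.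
    under [RHS]eq_bigr do rewrite cv.
    rewrite sum_cells !indicE; congr (nat_of_bool _)%:R.
    apply/idP/idP; rewrite !inE no_hit_bigcup -bigcup_seq.
      by move=> [a _ [/cellsE <-]].
    move=> h; exists (cell_of m w); first by rewrite /= mem_index_enum.
    by split => //; exact/cellsE.
  rewrite ge0_integral_sum//; last first.
    by move=> a; apply/measurable_EFinP; apply: measurable_indic; exact: measurableI.
  apply: eq_bigr => a _.
  rewrite integral_indic ?setIT//; last exact: measurableI.
  exact: (parents_daughters_indep m (fun i => kappa @^-1` [set val (nth ord0 (fgraph a) i)])
    (fun i => S (nth ord0 (fgraph a) i))).
transitivity (\int[P]_w \sum_a ((\prod_(i < m) q (nth ord0 (fgraph a) i))%:E *
    (\1_(cells m a) w)%:E))%E.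
  rewrite ge0_integral_sum//; last 2 first.
  - move=> a; apply: measurable_funeM; apply/measurable_EFinP.
    exact: measurable_indic.
  - move=> a w _; rewrite -EFinM lee_fin mulr_ge0// prodr_ge0// => i _.
    exact: expR_ge0.
  apply: eq_bigr => a _; rewrite ge0_integralZl//; last 2 first.
  - apply/measurable_EFinP; exact: measurable_indic.
  - by rewrite lee_fin prodr_ge0// => i _; exact: expR_ge0.
  by rewrite integral_indic// setIT muleC.
apply: eq_integral => w _.
under eq_bigr do rewrite -EFinM.
rewrite sumEFin sum_cells; congr EFin; apply: eq_bigr => i _.
by rewrite nth_fgraph_ffun ffunE inordK ?ltnS.
Qed.

End Finite.
End IndependentVoid.

(** * Generating functional of the Poisson parents over finitely many cells *)

Lemma sum_nat_card (A : set nat) k : (A #= `I_k)%card ->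
  exists m0, forall m, (m0 <= m)%N -> (\sum_(i < m) (val i \in A) = k)%N.
Proof.
elim: k A => [|k IH] A.
  rewrite II0 card_eq0 => /eqP ->; exists 0%N => m _.
  by rewrite big1// => i _; rewrite in_set0.
move/eq_cardSP => [x Ax /IH[m0 H]]; exists (maxn m0 x.+1) => m.
rewrite geq_max => /andP[m0m xm]; have := H m m0m.
rewrite [in X in X -> _](bigD1 (Ordinal xm))//= memNset; last by move=> [_ /=].
rewrite add0n => Hk; rewrite (bigD1 (Ordinal xm))//= mem_set// add1n -[in RHS]Hk.
congr (_.+1); apply: eq_bigr => i ix; congr nat_of_bool.
rewrite in_setD [X in ~~ X]memNset ?andbT//.
by move=> ix'; move/eqP: ix; apply; apply: val_inj.
Qed.

(** Up to the factor exp(-lam) these are partial sums of the exponential series at lam s. The case s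
    = 1 says that the Poisson masses add up to 1. *)
Lemma pois_gf_cvg {R : realType} (lam s : R) :
  (\sum_(k < K) s ^+ k * pois lam k) @[K --> \oo] --> expR (- (lam * (1 - s))).
Proof.
rewrite (_ : expR _ = expR (lam * s) * expR (- lam)); last first.
  by rewrite -expRD; congr expR; ring.
rewrite (_ : (fun K => _) = (fun K => series (exp_coeff (lam * s)) K * expR (- lam))).
  by apply: cvgMl; exact: is_cvg_series_exp_coeff.
apply/funext => K; rewrite /series/= big_mkord mulr_suml; apply: eq_bigr => k _.
by rewrite /pois /exp_coeff/= exprMn; ring.
Qed.

Lemma prodr_itv01 {R : realType} (I : Type) (r : seq I) (f : I -> R) :
  (forall i, 0 <= f i <= 1) -> 0 <= \prod_(i <- r) f i <= 1.
Proof.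
move=> f01; elim/big_ind: _ => [|x y /andP[x0 x1] /andP[y0 y1]|//].
  by rewrite ler01 lexx.
by rewrite mulr_ge0//= mulr_ile1.
Qed.

Lemma cvg_prodr {R : realType} (I : Type) (r : seq I) (f : I -> nat -> R) (l : I -> R) :
  (forall i, f i m @[m --> \oo] --> l i) ->
  (\prod_(i <- r) f i m) @[m --> \oo] --> \prod_(i <- r) l i.
Proof.
move=> fl; elim: r => [|i r IH].
  by under eq_fun do rewrite big_nil; rewrite big_nil; exact: cvg_cst.
by under eq_fun do rewrite big_cons; rewrite big_cons; exact: cvgM.
Qed.

Section ParentsGeneratingFunction.
Context {R : realType} {n : nat} {d : measure_display} {Omega : measurableType d}.
Context (P : probability Omega R) (mu : {measure set (n.-tuple R) -> \bar R}).
Context (lp : R) (X : nat -> Omega -> n.-tuple R).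
Context (mX : forall i, measurable_fun setT (X i)).
Context (injX : forall w, injective (fun i => X i w)).
Context (poisX : poisson_process P mu lp setT (parents X)).
Context (kappa : n.-tuple R -> nat) (M : nat) (q : nat -> R).
Context (mkappa : forall j, measurable (kappa @^-1` [set j])).
Context (kappa_lty : forall c : 'I_M, (mu (kappa @^-1` [set val c]) < +oo)%E).
Context (q_ge0 : forall j, 0 <= q j) (q_le1 : forall j, q j <= 1).
Context (q_tail : forall j, (M <= j)%N -> q j = 1).

Let C (c : 'I_M) : set (n.-tuple R) := kappa @^-1` [set val c].
Let lam (c : 'I_M) : R := lp * fine (mu (C c)).
Let counts (a : 'I_M -> nat) : set Omega :=
  \bigcap_(c in [set: 'I_M]) count_event (parents X) (C c) (a c).
Let gf w m : R := \prod_(i < m) q (kappa (X i w)).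
(** The product of the q(c)^(count in c) on the event that all counts are below K, and 0 elsewhere:
    a finite sum whose integral is computed term by term. *)
Let gf_trunc w K : R :=
  \sum_(a : {ffun 'I_M -> 'I_K}) \prod_c q (val c) ^+ a c * \1_(counts (fun c => val (a c))) w.

Let measurable_count B k : measurable B -> measurable (count_event (parents X) B k).
Proof. by case: poisX => + _; apply. Qed.

Let measurable_counts a : measurable (counts a).
Proof. by apply: fin_bigcap_measurable => // c _; apply: measurable_count; exact: mkappa. Qed.

Let proba_counts a : P (counts a) = (\prod_c pois (lam c) (a c))%:E.
Proof.
case: poisX => _ /(_ M C a) ->.
- by congr EFin; apply: eq_bigr => c _; rewrite /lam setIT.
- by move=> c; split; [exact: mkappa|rewrite setIT kappa_lty].
- move=> c c' cc'; rewrite -subset0 => x [/= h1 h2].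
  by move/eqP: cc'; apply; apply: val_inj; rewrite -h1 -h2.
Qed.

Lemma integral_gf_trunc K : (\int[P]_w (gf_trunc w K)%:E)%E =
  (\prod_c \sum_(k < K) q (val c) ^+ k * pois (lam c) k)%:E.
Proof.
transitivity (\int[P]_w \sum_(a : {ffun 'I_M -> 'I_K})
    ((\prod_c q (val c) ^+ a c)%:E * (\1_(counts (fun c => val (a c))) w)%:E))%E.
  by apply: eq_integral => w _; rewrite sumEFin.
rewrite ge0_integral_sum//; last 2 first.
- move=> a; apply: measurable_funeM; apply/measurable_EFinP.
  exact: measurable_indic.
- move=> a w _; rewrite -EFinM lee_fin mulr_ge0// prodr_ge0// => c _.
  by rewrite exprn_ge0.
rewrite bigA_distr_bigA/= -sumEFin; apply: eq_bigr => a _.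
rewrite ge0_integralZl//; last 2 first.
- apply/measurable_EFinP; exact: measurable_indic.
- by rewrite lee_fin prodr_ge0// => c _; rewrite exprn_ge0.
rewrite integral_indic// (setIT (counts _)).
by rewrite [X in (_ * X)%E](proba_counts (fun c => val (a c))) -EFinM -big_split.
Qed.

(** An infinite number of points belongs to no [count_event]; the events for finite k are disjoint
    and their Poisson masses add up to 1. *)
Let count_finite_ae c : {ae P, forall w, exists k, count_event (parents X) (C c) k w}.
Proof.
have mC k : measurable (count_event (parents X) (C c) k).
  by apply: measurable_count; exact: mkappa.
have mU : measurable (\bigcup_k count_event (parents X) (C c) k) by exact: bigcupT_measurable.
exists (~` \bigcup_k count_event (parents X) (C c) k); split; first exact: measurableC.
  rewrite probability_setC// measure_bigcup//; last first.
    apply/trivIsetP => i j _ _ ij; rewrite -subset0 => w [hi hj].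
    move/eqP: ij; apply; apply/card_eq_II.
    by apply: card_eq_trans hj; rewrite card_eq_sym.
  rewrite [X in (1 - X)%E](_ : _ = 1%E) ?subee//.
  apply/cvg_lim => //.
  have -> : 1%E = (expR (- (lam c * (1 - 1))))%:E :> \bar R by rewrite subrr mulr0 oppr0 expR0.
  rewrite (_ : (fun K => _) = EFin \o (fun K => \sum_(k < K) 1 ^+ k * pois (lam c) k)).
    by apply: cvg_EFin; [exact: nearW|exact: pois_gf_cvg].
  apply/funext => K /=; rewrite big_mkord -sumEFin.
  apply: eq_big => k; rewrite ?in_setT// => _.
  rewrite (proba_count_event _ _ _ _ _ _ _ poisX); [|exact: mkappa|by rewrite setIT kappa_lty].
  by rewrite expr1n mul1r setIT.
by apply: subsetC => w [k _ hk]; exists k.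
Qed.

Let counts_uniq a b w : counts a w -> counts b w -> a = b.
Proof.
move=> ha hb; apply/funext => c; apply/card_eq_II.
apply: card_eq_trans (hb c I); rewrite card_eq_sym; exact: (ha c I).
Qed.

(** The finitely many labels of parents in the first M cells all lie below some m; later labels
    contribute factors 1, and grouping the others by cell gives powers. *)
Let gf_countsE a w : counts a w ->
  \forall m \near \oo, gf w m = \prod_c q (val c) ^+ a c.
Proof.
move=> ha.
(* Injectivity of the labelling turns the number of points in a cell into the number of labels. *)
have card_c (c : 'I_M) : ([set i | kappa (X i w) = c] #= `I_(a c))%card.
  apply: card_eq_trans (ha c I).
  rewrite (_ : parents X w `&` C c = (fun i => X i w) @` [set i | kappa (X i w) = c]).
    by rewrite card_eq_sym; apply: inj_card_eq => i j _ _; exact: injX.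
  apply/seteqP; split => [x [[i _ <-] xc]|x [i ic <-]]; first by exists i.
  by split => //; exists i.
have /choice[m0 Hm0] (c : 'I_M) := sum_nat_card _ _ (card_c c).
exists (\max_c m0 c)%N => // m /= m0m.
have qE j : q j = \prod_(c : 'I_M) q (val c) ^+ (j == val c).
  have [jM|Mj] := ltnP j M; last first.
    rewrite (q_tail j Mj) big1// => c _.
    by rewrite gtn_eqF// (leq_trans (ltn_ord c)).
  rewrite (bigD1 (Ordinal jM))//= eqxx expr1 big1 ?mulr1// => c cj.
  by rewrite (_ : (j == c) = false)//; apply: contraNF cj => /eqP jc; apply/eqP/val_inj.
rewrite /gf; under [LHS]eq_bigr do rewrite qE.
rewrite exchange_big/=; apply: eq_bigr => c _.
rewrite prodrXr; congr (_ ^+ _).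
rewrite -(Hm0 c m); last first.
  by apply: leq_trans m0m; exact: leq_bigmax.
by apply: eq_bigr => i _; congr nat_of_bool; apply/eqP/idP; rewrite inE.
Qed.

Let gf_trunc_countsE a w : counts a w ->
  \forall K \near \oo, gf_trunc w K = \prod_c q (val c) ^+ a c.
Proof.
move=> ha; exists (\max_c a c).+1%N => // K /= aK.
have aKc c : (a c < K)%N by rewrite (leq_ltn_trans _ aK)//; exact: leq_bigmax.
pose b : {ffun 'I_M -> 'I_K} := [ffun c => Ordinal (aKc c)].
have ab c : b c = a c :> nat by rewrite ffunE.
have hb : counts (fun c => val (b c)) w by rewrite (_ : (fun c => _) = a)//; apply/funext.
rewrite /gf_trunc (bigD1 b)//= indicE mem_set// mulr1 [X in _ + X]big1 ?addr0.
  by apply: eq_bigr => c _; rewrite ab.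
move=> a' a'b; rewrite indicE memNset ?mulr0// => ha'.
move/eqP: a'b; apply; apply/ffunP => c; apply: val_inj.
by have /(congr1 (@^~ c)) := counts_uniq _ _ _ ha' hb.
Qed.

Let gf_bound w m : 0 <= gf w m <= 1.
Proof.
by apply: prodr_itv01 => i; rewrite q_ge0 q_le1.
Qed.

Let gf_trunc_bound w K : 0 <= gf_trunc w K <= 1.
Proof.
have g0 (a : {ffun 'I_M -> 'I_K}) : 0 <= \prod_c q (val c) ^+ a c.
  by apply: prodr_ge0 => c _; rewrite exprn_ge0.
apply/andP; split; first by apply: sumr_ge0 => a _; rewrite mulr_ge0.
have [[a ha]|noa] := pselect (exists a : {ffun 'I_M -> 'I_K}, counts (fun c => val (a c)) w).
  rewrite /gf_trunc (bigD1 a)//= [X in _ + X]big1 ?addr0.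
    rewrite indicE mem_set// mulr1.
    suff /andP[] : 0 <= \prod_c q (val c) ^+ a c <= 1 by [].
    by apply: prodr_itv01 => c; rewrite exprn_ge0//= exprn_ile1.
  move=> b ba; rewrite indicE memNset ?mulr0// => hb.
  move/eqP: ba; apply; apply/ffunP => c; apply: val_inj.
  by have /(congr1 (@^~ c)) := counts_uniq _ _ _ hb ha.
rewrite /gf_trunc big1// => a _; rewrite indicE memNset ?mulr0// => ha.
by apply: noa; exists a.
Qed.

Let measurable_gf m : measurable_fun setT (gf ^~ m).
Proof.
apply: measurable_prod => i _ /=.
suff mf j : measurable ((kappa \o X i) @^-1` [set j]).
  exact: (measurable_fun_fibers (kappa \o X i) q mf).
rewrite comp_preimage.
exact: (measurable_preimage _ _ _ _ _ _ (mX i)).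
Qed.

Let measurable_gf_trunc K : measurable_fun setT (gf_trunc ^~ K).
Proof.
apply: measurable_sum => a; apply: measurable_funM => //; exact: measurable_indic.
Qed.

(* Almost surely each cell c < M contains finitely many parents, say a c, so that for large m both
   gf w m and gf_trunc w m equal prod_c q c ^ (a c); hence their integrals have the same limit. *)
Lemma parents_gf_cvg : (\int[P]_w (\prod_(i < m) q (kappa (X i w)))%:E @[m --> \oo] -->
  (expR (- \sum_c lam c * (1 - q (val c))))%:E)%E.
Proof.
have intb (f : Omega -> nat -> R) m : (forall w, 0 <= f w m <= 1) -> measurable_fun setT (f ^~ m) ->
    P.-integrable setT (fun w => (f w m)%:E).
  move=> f01 mf; apply: (@le_integrable _ _ _ _ _ measurableT _ (cst 1%E)).
  - exact/measurable_EFinP.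
  - by move=> w _ /=; rewrite lee_fin normr1 ger0_norm; have /andP[] := f01 w.
  - exact: finite_measure_integrable_cst.
have trunc_cvg : (\int[P]_w (gf_trunc w m)%:E @[m --> \oo] -->
    (expR (- \sum_c lam c * (1 - q (val c))))%:E)%E.
  under eq_fun do rewrite integral_gf_trunc.
  apply/cvg_EFin; first by apply: nearW.
  rewrite /comp/= (_ : expR _ = \prod_c expR (- (lam c * (1 - q (val c))))).
    by apply: cvg_prodr => c; exact: pois_gf_cvg.
  by rewrite -sumrN expR_sum.
(* Dominated convergence is applied to the difference, whose limit is the constant 0, so that no
   measurable limit of [gf] has to be exhibited. *)
suff diff_cvg : (\int[P]_w (gf w m - gf_trunc w m)%:E @[m --> \oo] --> 0)%E.
  rewrite (_ : (fun m => _) = (fun m => \int[P]_w (gf w m - gf_trunc w m)%:E +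
      \int[P]_w (gf_trunc w m)%:E)%E).
    rewrite -[X in _ --> X]add0e; apply: cvgeD => //.
  apply/funext => m; rewrite -integralD//=; first last.
  - exact: intb.
  - by under eq_fun do rewrite EFinB; apply: integrableB => //; exact: intb.
  - by apply: eq_integral => w _; rewrite -EFinD subrK.
pose f_ m w := (gf w m - gf_trunc w m)%:E.
have mf_ m : measurable_fun setT (f_ m) by apply/measurable_EFinP; exact: measurable_funB.
have f_0 : {ae P, forall w, setT w -> f_ ^~ w @ \oo --> cst 0%E w}.
  have := @filter_forall _ _ _ _ (ae_filter_ringOfSetsType P) count_finite_ae.
  apply: filterS => w /choice[a ha] _.
  have ca : counts a w by move=> c _; exact: ha.
  apply: cvg_near_cst; near=> m; rewrite /f_.
  by rewrite (near (gf_countsE _ _ ca) m)// (near (gf_trunc_countsE _ _ ca) m)// ?subrr.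
have f_1 : {ae P, forall w m, setT w -> (`|f_ m w| <= cst 1%E w)%E}.
  apply: aeW => w m _; rewrite lee_fin ler_norml.
  have /andP[h1 h2] := gf_bound w m; have /andP[h3 h4] := gf_trunc_bound w m.
  by apply/andP; split; lra.
have i1 : P.-integrable setT (cst 1%E) by exact: finite_measure_integrable_cst.
have [_ _] := dominated_convergence measurableT mf_ (measurable_cst 0%E) f_0 i1 f_1.
by rewrite integral0.
Unshelve. all: by end_near.
Qed.

End ParentsGeneratingFunction.

(** * From finitely many to countably many cells *)

Section CellVoid.
Context {R : realType} {n : nat} {d : measure_display} {Omega : measurableType d}.
Context (P : probability Omega R) (mu : {measure set (n.-tuple R) -> \bar R}).
Context (lp ld rd : R) (X : nat -> Omega -> n.-tuple R) (D : nat -> Omega -> set (n.-tuple R)).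
Context (mcpX : is_mcp P mu lp ld rd X D).
Context (ld_ge0 : 0 <= ld).
Context (ball_lty : (mu (cball origin rd) < +oo)%E).
Context (kappa : n.-tuple R -> nat) (S : nat -> set (n.-tuple R)).
Context (mkappa : forall j, measurable (kappa @^-1` [set j])).
Context (kappa_lty : forall j, (mu (kappa @^-1` [set j]) < +oo)%E).
Context (mS : forall j, measurable (S j)).

Local Notation void := (void_proba mu ld rd).

(* Cells of index at least M are merged into a single cell, to which the empty set is assigned. *)
Let kappaM M x := minn (kappa x) M.
Let SM M j := if (j < M)%N then S j else set0.

Let no_hitM M : set Omega := \bigcap_m no_hit X D (kappaM M) (SM M) m.

Definition no_hits : set Omega := [set w | forall i, D i w `&` S (kappa (X i w)) = set0].

Lemma void_le1 B : 0 <= void B <= 1.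
Proof. by rewrite /void_proba expR_ge0/= -expR0 ler_expR oppr_le0 mulr_ge0// fine_ge0. Qed.

Lemma void_set0 : void set0 = 1.
Proof. by rewrite /void_proba set0I measure0/= mulr0 oppr0 expR0. Qed.

Let mkappaM M j : measurable (kappaM M @^-1` [set j]).
Proof.
rewrite (_ : _ @^-1` _ = \bigcup_(k in [set k | minn k M = j]) kappa @^-1` [set k]).
  by apply: bigcup_measurable.
by apply/seteqP; split => [x /= h|x [k /= <- <-]] //; exists (kappa x).
Qed.

Let mSM M j : measurable (SM M j).
Proof. by rewrite /SM; case: ifP. Qed.

Let measurable_no_hit M m : measurable (no_hit X D (kappaM M) (SM M) m).
Proof.
apply: (measurable_no_hit_fin P mu lp ld rd X D mcpX _ _ M (mkappaM M) (mSM M)).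
by move=> x; exact: geq_minr.
Qed.

Let kappaM_fiber M (c : 'I_M) : kappaM M @^-1` [set val c] = kappa @^-1` [set val c].
Proof.
apply/seteqP; split => x /=; rewrite /kappaM.
  by rewrite /minn; case: ifP => // _ Mc; have := ltn_ord c; rewrite -Mc ltnn.
by move=> ->; apply/minn_idPl/ltnW.
Qed.

(** The probabilities for the first m parents have two limits: [P (no_hitM M)] by continuity from
    above, and the exponential by the generating functional. *)
Let proba_no_hitM M : P (no_hitM M) =
  (expR (- \sum_(c < M) lp * fine (mu (kappa @^-1` [set val c])) * (1 - void (S c))))%:E.
Proof.
have kMM x : (kappaM M x <= M)%N by exact: geq_minr.
have c1 : P (no_hit X D (kappaM M) (SM M) m) @[m --> \oo] --> P (no_hitM M).
  apply: nonincreasing_cvg_mu => //.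
  - by rewrite (le_lt_trans (probability_le1 _ _))// ltry.
  - by apply: bigcapT_measurable.
  - by move=> m m' mm'; apply/subsetPset => w h i im; apply: h; exact: leq_trans mm'.
have [mX injX poisX _ _] := mcpX.
have c2 := parents_gf_cvg P mu lp X mX injX poisX (kappaM M) M (fun j => void (SM M j)) (mkappaM M).
apply: (cvg_unique _ c1); first exact: ereal_hausdorff.
rewrite (_ : (fun m => _) = (fun m =>
    \int[P]_w (\prod_(i < m) void (SM M (kappaM M (X i w))))%:E)%E).
  have -> : \sum_(c < M) lp * fine (mu (kappa @^-1` [set val c])) * (1 - void (S c)) =
      \sum_(c < M) lp * fine (mu (kappaM M @^-1` [set val c])) * (1 - void (SM M (val c))).
    by apply: eq_bigr => c _; rewrite kappaM_fiber /SM ltn_ord.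
  apply: c2.
  - by move=> c; rewrite kappaM_fiber.
  - by move=> j; have /andP[] := void_le1 (SM M j).
  - by move=> j; have /andP[] := void_le1 (SM M j).
  - by move=> j Mj; rewrite /SM ltnNge Mj/= void_set0.
apply/funext => m.
exact: (proba_no_hit P mu lp ld rd X D mcpX ball_lty (kappaM M) (SM M) M (mkappaM M) (mSM M) kMM m).
Qed.

Let measurable_no_hitM M : measurable (no_hitM M).
Proof. exact: bigcapT_measurable. Qed.

Let no_hitsE : no_hits = \bigcap_M no_hitM M.
Proof.
apply/seteqP; split => w h.
  move=> M _ m _ i im; rewrite /SM; case: ifP; last by rewrite setI0.
  rewrite /kappaM gtn_min ltnn orbF => kM.
  by rewrite (minn_idPl (ltnW kM)).
(* The level [(kappa (X i w)).+1] is the first at which the cell of parent i is not merged, and the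
   first [i.+1] parents include it. *)
move=> i; have := h (kappa (X i w)).+1 I i.+1 I i (ltnSn i).
by rewrite /kappaM (minn_idPl (leqnSn _)) /SM ltnSn.
Qed.

Lemma measurable_no_hits : measurable no_hits.
Proof. by rewrite no_hitsE; exact: bigcapT_measurable. Qed.

Let nonincreasing_no_hitM : nonincreasing_seq no_hitM.
Proof.
move=> M M' MM'; apply/subsetPset => w h m _ i im; rewrite /SM; case: ifP; last by rewrite setI0.
rewrite /kappaM gtn_min ltnn orbF => kM.
have := h i.+1 I i (ltnSn i).
have kM' := leq_trans kM MM'.
by rewrite /SM /kappaM (minn_idPl (ltnW kM')) (minn_idPl (ltnW kM)) kM'.
Qed.

Lemma proba_no_hits : (\int[mu]_x (1 - void (S (kappa x)))%:E < +oo)%E ->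
  P no_hits = (expR (- (lp * fine (\int[mu]_x (1 - void (S (kappa x)))%:E))))%:E.
Proof.
move=> Ilty; set I := (\int[mu]_x _)%E in Ilty *.
have v0 x : 0 <= 1 - void (S (kappa x)).
  by rewrite subr_ge0; have /andP[] := void_le1 (S (kappa x)).
have I0 : (0 <= I)%E by apply: integral_ge0 => x _; rewrite lee_fin.
have Ifin : I \is a fin_num by rewrite ge0_fin_numE.
have c1 : P (no_hitM M) @[M --> \oo] --> P no_hits.
  rewrite no_hitsE; apply: nonincreasing_cvg_mu => //.
  - by rewrite (le_lt_trans (probability_le1 _ _))// ltry.
  - by rewrite -no_hitsE; exact: measurable_no_hits.
have fiber_int c : (\int[mu]_(x in kappa @^-1` [set c]) (1 - void (S (kappa x)))%:E =
    ((1 - void (S c)) * fine (mu (kappa @^-1` [set c])))%:E)%E.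
  rewrite EFinM fineK; last by rewrite ge0_fin_numE.
  rewrite -(integral_cst mu (mkappa c) (1 - void (S c))%:E).
  by apply: eq_integral => x; rewrite inE/= => ->.
have mv : measurable_fun setT (fun x => (1 - void (S (kappa x)))%:E).
  apply/measurable_EFinP.
  exact: (measurable_fun_fibers kappa (fun j => 1 - void (S j))).
(* The integrand is constant on each fibre of [kappa], so additivity over the fibres makes the
   exponents partial sums of a series with value I. *)
have sumI : (\sum_(c < M) (1 - void (S c)) * fine (mu (kappa @^-1` [set val c])))
    @[M --> \oo] --> fine I.
  suff : ((\sum_(c < M) (1 - void (S c)) * fine (mu (kappa @^-1` [set val c])))%:E
      @[M --> \oo] --> I)%E by rewrite -{1}(fineK Ifin) => /fine_cvgP[].
  rewrite (_ : I = \sum_(c <oo) \int[mu]_(x in kappa @^-1` [set c]) (1 - void (S (kappa x)))%:E)%E.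
    rewrite (_ : (fun M => _) = (fun M => \sum_(0 <= c < M)
        \int[mu]_(x in kappa @^-1` [set c]) (1 - void (S (kappa x)))%:E)%E).
      by apply: is_cvg_nneseries => c _ _; apply: integral_ge0 => x _; rewrite lee_fin.
    apply/funext => M; rewrite big_mkord -sumEFin; apply: eq_bigr => c _.
    by rewrite fiber_int.
  rewrite -ge0_integral_bigcup//=; last 3 first.
  - exact: measurable_funTS.
  - by move=> x _; rewrite lee_fin.
  - apply/trivIsetP => i j _ _ ij; rewrite -subset0 => x [/= h1 h2].
    by move/eqP: ij; apply; rewrite -h1 -h2.
  congr (integral _ _ _); apply/seteqP; split => // x _; by exists (kappa x).
move: c1; rewrite (_ : (fun M => _) = (fun M =>
    (expR (- \sum_(c < M) lp * fine (mu (kappa @^-1` [set val c])) * (1 - void (S c))))%:E)).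
  move=> c1; apply: (cvg_unique _ c1); first exact: ereal_hausdorff.
  apply: cvg_EFin; first exact: nearW.
  apply: continuous_cvg; first exact: continuous_expR.
  apply: cvgN; rewrite (_ : (fun M => _) = (fun M => lp *
    \sum_(c < M) (1 - void (S c)) * fine (mu (kappa @^-1` [set val c])))).
    by apply: cvgMr.
  by apply/funext => M; rewrite mulr_sumr; apply: eq_bigr => c _; ring.
by apply/funext => M; exact: proba_no_hitM.
Qed.

End CellVoid.

(** * The contact distance *)

Section Grid.
Context {R : realType} {n : nat}.

(** An enumeration of the points with rational coordinates; numbers that code no point are sent to
    the origin. *)
Let rational_point (j : nat) : n.-tuple R :=
  if unpickle j is Some z then [tuple ratr (tnth (z : n.-tuple rat) i) | i < n] else origin.

Let rational_point_dense (e : R) (x : n.-tuple R) : 0 < e ->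
  exists j, tnorm (tsub x (rational_point j)) <= e.
Proof.
(* An error of e / (n + 1) in each coordinate gives at most n e / (n + 1) <= e in norm, with a
   denominator that is never 0. *)
move=> e0; pose c := e / n.+1%:R; have c0 : 0 < c by rewrite divr_gt0.
have /choice[z Hz] (i : 'I_n) : exists p : rat, `|tnth x i - ratr p| <= c.
  have [|p] := @rat_in_itvoo R (tnth x i - c) (tnth x i + c).
    by rewrite ltrBlDr -addrA ltrDl addr_gt0.
  rewrite in_itv/= => /andP[h1 h2]; exists p; rewrite ler_norml; apply/andP; split; lra.
exists (pickle [tuple z i | i < n]); rewrite /rational_point pickleK.
apply: (@le_trans _ _ (n%:R * c)).
  by apply: tnorm_le_bound => [|i]; [exact: ltW|rewrite tnthE !tnth_mktuple; exact: Hz].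
rewrite /c mulrCA; apply: ler_piMr; first exact: ltW.
by rewrite ler_pdivrMr// mul1r ler_nat.
Qed.

(** [kappa x] is the least index of a rational point within e of [x]; a fibre is thus a ball minus
    finitely many earlier ones. *)
Lemma exists_grid (e : R) : 0 < e -> exists kappa : n.-tuple R -> nat, exists y : nat -> n.-tuple R,
  (forall j, measurable (kappa @^-1` [set j])) /\
  (forall x, tnorm (tsub x (y (kappa x))) <= e).
Proof.
move=> e0; pose ex x := rational_point_dense e x e0.
exists (fun x => ex_minn (ex x)), rational_point; split; last first.
  by move=> x; case: ex_minnP.
move=> j; rewrite (_ : _ @^-1` _ = cball (rational_point j) e `\`
    \bigcup_(i in [set i | (i < j)%N]) cball (rational_point i) e).
  apply: measurableD; first exact: measurable_cball.
  by apply: bigcup_measurable => i _; exact: measurable_cball.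
apply/seteqP; split => x /=; case: ex_minnP => m hm minm.
  move=> <-; split => // -[i /= im]; rewrite /cball/= => /minm.
  by rewrite leqNgt im.
move=> [hj nj]; apply/eqP; rewrite eqn_leq minm//= leqNgt; apply/negP => mj.
by apply: nj; exists m.
Qed.

End Grid.

(** * Removing the rounding of the parents *)

Section Contact.
Context {R : realType} {n : nat} {d : measure_display} {Omega : measurableType d}.
Context (P : probability Omega R) (mu : {measure set (n.-tuple R) -> \bar R}).
Context (mu_leb : is_lebesgue_n mu).
Context (lp ld rd : R) (X : nat -> Omega -> n.-tuple R) (D : nat -> Omega -> set (n.-tuple R)).
Context (mcpX : is_mcp P mu lp ld rd X D).
Context (ld_ge0 : 0 <= ld) (r : R).

Local Notation void := (void_proba mu ld rd).
Local Notation opp := (tscale (-1)).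

Definition contact_gt : set Omega := [set w | (r%:E < contact_dist (mcp X D) w)%E].

Let eps (k : nat) : R := k.+1%:R^-1.

Let eps_gt0 k : 0 < eps k. Proof. by rewrite invr_gt0. Qed.

Let eps_le1 k : eps k <= 1. Proof. by rewrite invf_le1// ler1n. Qed.

Let eps_cvg0 : eps k @[k --> \oo] --> (0 : R).
Proof. exact: cvg_harmonic. Qed.

Context (kappa : nat -> n.-tuple R -> nat) (y : nat -> nat -> n.-tuple R).
Context (mkappa : forall k j, measurable (kappa k @^-1` [set j])).
Context (kappa_dist : forall k x, tnorm (tsub x (y k (kappa k x))) <= eps k / 2).

(** Daughters are given relative to their parent, so a hit is membership in a ball around the
    opposite of the parent. The enlargement [eps k] is twice the rounding error, which leaves a
    margin of [eps k / 2]. *)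
Let S k j : set (n.-tuple R) := cball (opp (y k j)) (r + eps k).
Let F k : set Omega := no_hits X D (kappa k) (S k).

Let mS k j : measurable (S k j). Proof. exact: measurable_cball. Qed.

Let cball_opp (x : n.-tuple R) (s : R) : cball (opp x) s = [set z | tnorm (tadd x z) <= s].
Proof.
apply/seteqP; split => z; rewrite /cball/=;
  rewrite (_ : tsub z (opp x) = tadd x z)//; apply: eq_from_tnth => i; rewrite !tnthE; ring.
Qed.

Let kappa_lty k j : (mu (kappa k @^-1` [set j]) < +oo)%E.
Proof.
apply: le_lt_trans (cball_lebesgue_lty mu mu_leb (y k j) (eps k / 2)).
apply: le_measure; rewrite ?inE//; first exact: measurable_cball.
by move=> x /= <-; exact: kappa_dist.
Qed.

Let measurable_F k : measurable (F k).
Proof. exact: (measurable_no_hits P mu lp ld rd X D mcpX). Qed.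

Let tadd_dist (x z1 z2 : n.-tuple R) : tnorm (tadd z1 x) <= tnorm (tadd z2 x) + tnorm (tsub z1 z2).
Proof.
apply: le_trans (tnormD _ _); rewrite (_ : tadd (tadd _ _) _ = tadd z1 x)//.
by apply: eq_from_tnth => i; rewrite !tnthE; ring.
Qed.

Let sub_S_ball k x : cball (opp x) r `<=` S k (kappa k x).
Proof.
move=> z; rewrite /S !cball_opp/= => xz.
apply: le_trans (tadd_dist _ _ x) _.
have := kappa_dist k x; rewrite tnormN; have := eps_gt0 k; lra.
Qed.

(** Enlargement and rounding cost [eps k + eps k / 2], bounded by [2 * eps k]. *)
Let S_ball_sub k x : S k (kappa k x) `<=` cball (opp x) (r + 2 * eps k).
Proof.
move=> z; rewrite /S !cball_opp/= => xz.
apply: le_trans (tadd_dist _ _ (y k (kappa k x))) _.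
have := kappa_dist k x; have := eps_gt0 k; lra.
Qed.

(** The margin keeps every point beyond [r + eps k / 2], so the infimum, attained or not, is
    strictly above [r]. *)
Let F_sub k : F k `<=` contact_gt.
Proof.
move=> w Fw; rewrite /contact_gt/=.
apply: (@lt_le_trans _ _ (r + eps k / 2)%:E).
  by rewrite lte_fin ltrDl divr_gt0.
apply/ereal_infP => _ [_ [i _ [z Dz <-]] <-]; rewrite lee_fin leNgt; apply/negP => zr.
have /seteqP[+ _] := Fw i; apply; split; first exact: Dz.
rewrite /S cball_opp/=.
apply: le_trans (tadd_dist _ _ (X i w)) _.
have := kappa_dist k (X i w); rewrite tnormN; lra.
Qed.

Let contact_gt_F w : contact_gt w -> \forall k \near \oo, F k w.
Proof.
move=> rw.
(* [s] is the contact distance itself when finite, and r + 1 when the process is empty. *)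
have [s rs sw] : exists2 s, r < s & (s%:E <= contact_dist (mcp X D) w)%E.
  move: rw; rewrite /contact_gt/=; case: (contact_dist _ _) => [s||]//.
  - by rewrite lte_fin => rs; exists s.
  - by move=> _; exists (r + 1); rewrite ?ltrDl// leey.
have : \forall k \near \oo, eps k < (s - r) / 2.
  by apply: cvgr_lt eps_cvg0 _ _; rewrite divr_gt0// subr_gt0.
apply: filterS => k ks i; rewrite -subset0 => z [Dz].
move=> /(S_ball_sub k (X i w)); rewrite cball_opp/= => zr.
have : (s%:E <= (tnorm (tadd (X i w) z))%:E)%E.
  by apply: le_trans sw _; apply: ereal_inf_lbound; exists (tadd (X i w) z) => //;
    exists i => //; exists z.
rewrite lee_fin; lra.
Qed.

Lemma measurable_contact_gt : measurable contact_gt.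
Proof.
rewrite (_ : contact_gt = \bigcup_k F k); first exact: bigcupT_measurable.
apply/seteqP; split => w; last by move=> [k _ /F_sub].
by move=> /contact_gt_F[k _ /(_ k (leqnn k))]; exists k.
Qed.

(** The grids for different k are unrelated, so the events [F k] need not be monotone: the
    indicators converge pointwise and dominated convergence replaces continuity of measure. *)
Let F_cvg : P (F k) @[k --> \oo] --> P contact_gt.
Proof.
have indP A : measurable A -> P A = (\int[P]_w (\1_A w)%:E)%E.
  by move=> mA; rewrite integral_indic// setIT.
rewrite indP; last exact: measurable_contact_gt.
under eq_fun do rewrite indP//.
have m1 k : measurable_fun setT (fun w => (\1_(F k) w : R)%:E).
  by apply/measurable_EFinP; exact: measurable_indic.
have m2 : measurable_fun setT (fun w => (\1_contact_gt w : R)%:E).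
  by apply/measurable_EFinP; apply: measurable_indic; exact: measurable_contact_gt.
have F_cvg1 : {ae P, forall w, setT w ->
    (fun k => (\1_(F k) w : R)%:E) @ \oo --> (\1_contact_gt w : R)%:E}.
  apply: aeW => w _; apply: cvg_near_cst.
  have [cw|cw] := pselect (contact_gt w).
    by apply: filterS (contact_gt_F _ cw) => k Fkw; rewrite !indicE !mem_set.
  by apply: nearW => k; rewrite !indicE !memNset// => /F_sub.
have F_le1 : {ae P, forall w k, setT w -> (`|(\1_(F k) w : R)%:E| <= cst 1%E w)%E}.
  apply: aeW => w k _; rewrite lee_fin ger0_norm ?indicE//.
  by case: (w \in _).
have i1 : P.-integrable setT (cst 1%E) by exact: finite_measure_integrable_cst.
by have [_ _] := dominated_convergence measurableT m1 m2 F_cvg1 i1 F_le1.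
Qed.

Let lens_lty B : measurable B -> (mu (B `&` cball origin rd) < +oo)%E.
Proof.
move=> mB; apply: le_lt_trans (cball_lebesgue_lty mu mu_leb origin rd).
apply: le_measure; rewrite ?inE//; last exact: measurable_cball.
by apply: measurableI => //; exact: measurable_cball.
Qed.

Let lens_fin B : measurable B -> mu (B `&` cball origin rd) \is a fin_num.
Proof. by move=> mB; rewrite ge0_fin_numE// lens_lty. Qed.

Let le_lens A B : measurable A -> measurable B -> A `<=` B ->
  (mu (A `&` cball origin rd) <= mu (B `&` cball origin rd))%E.
Proof.
move=> mA mB AB; apply: le_measure; rewrite ?inE; last exact: setSI.
  by apply: measurableI => //; exact: measurable_cball.
by apply: measurableI => //; exact: measurable_cball.
Qed.

Lemma measurable_void_opp : measurable_fun setT (fun x => void (cball (opp x) r)).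
Proof.
apply: measurableT_comp; first exact: measurable_expR.
apply: measurableT_comp; first exact: oppr_measurable.
apply: measurable_funM => //; apply: measurableT_comp; first exact: fine_measurable.
pose L := [set z : n.-tuple R * n.-tuple R | tnorm (tadd z.1 z.2) <= r /\ tnorm z.2 <= rd].
rewrite (_ : (fun x => _) = (fun x => mu (xsection L x))).
  apply: measurable_measure_xsection; first exact: sigma_finite_lebesgue.
  rewrite (_ : L = (fun z => tadd z.1 z.2) @^-1` cball origin r `&` snd @^-1` cball origin rd).
    apply: measurableI.
      by apply: measurable_preimage; [exact: measurable_tadd|exact: measurable_cball].
    by apply: measurable_preimage; [exact: measurable_snd|exact: measurable_cball].
  by rewrite !cball0E.
apply/funext => x; congr (mu _); rewrite cball_opp cball0E.
by apply/seteqP; split => z; rewrite /xsection/= inE.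
Qed.

(** The lens is squeezed between those of radii r and [r + 2 * eps k]; closed balls decrease to the
    closed ball, so continuity from above applies. *)
Let void_cvg x : void (S k (kappa k x)) @[k --> \oo] --> void (cball (opp x) r).
Proof.
rewrite /void_proba; apply: continuous_cvg; first exact: continuous_expR.
apply: cvgN; apply: cvgMr; apply: fine_cvg.
rewrite fineK; last by apply: lens_fin; exact: measurable_cball.
pose B k := cball (opp x) (r + 2 * eps k) `&` cball origin rd.
have mB k : measurable (B k) by apply: measurableI; exact: measurable_cball.
have BE : \bigcap_k B k = cball (opp x) r `&` cball origin rd.
  apply/seteqP; split => z.
    move=> h; split; last by have [] := h 0%N I.
    rewrite cball_opp/=; apply/ler_addgt0Pr => e e0.
    have [k _ /(_ k (leqnn k))/= ke] : \forall k \near \oo, eps k < e / 2.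
      by apply: cvgr_lt eps_cvg0 _ _; rewrite divr_gt0.
    have [+ _] := h k I; rewrite cball_opp/=; lra.
  move=> [h1 h2] k _; split => //; move: h1; rewrite !cball_opp/=.
  have := eps_gt0 k; lra.
have cB : mu (B k) @[k --> \oo] --> mu (cball (opp x) r `&` cball origin rd).
  rewrite -BE; apply: nonincreasing_cvg_mu => //.
  - by apply: lens_lty; exact: measurable_cball.
  - exact: bigcapT_measurable.
  - move=> k k' kk'; apply/subsetPset => z [h1 h2]; split => //.
    move: h1; rewrite !cball_opp/=.
    have : eps k' <= eps k by rewrite lef_pV2 ?posrE// ler_nat ltnS.
    lra.
apply: (@squeeze_cvge _ _ _ _ (fun=> mu (cball (opp x) r `&` cball origin rd)) _ (mu \o B)).
- apply: nearW => k; apply/andP; split.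
    by apply: le_lens; [exact: measurable_cball|exact: mS|exact: sub_S_ball].
  by apply: le_lens; [exact: mS|exact: measurable_cball|exact: S_ball_sub].
- exact: cvg_cst.
- exact: cB.
Qed.

(** This yields the dominating indicator: [eps k <= 1] bounds the enlarged radius by r + 2, and a
    parent farther than r + 2 + rd cannot reach that ball. *)
Let void_far k x : ~ cball origin (r + rd + 2) x -> void (S k (kappa k x)) = 1.
Proof.
rewrite cball0E/= => /negP; rewrite -ltNge => xr.
rewrite /void_proba (_ : S _ _ `&` _ = set0) ?measure0 ?mulr0 ?oppr0 ?expR0//.
rewrite -subset0 => z [/S_ball_sub]; rewrite cball_opp cball0E/= => h1 h2.
have : tnorm x <= tnorm (tadd x z) + tnorm z.
  apply: le_trans (_ : _ <= tnorm (tadd x z) + tnorm (opp z)) _.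
    apply: le_trans (tnormD _ _); rewrite (_ : tadd (tadd _ _) _ = x)//.
    by apply: eq_from_tnth => i; rewrite !tnthE; ring.
  by rewrite lerD2l (_ : tnorm (opp z) = tnorm z)//; apply: tnorm_eq; rewrite !tdotE; ring.
have := eps_le1 k; lra.
Qed.

Let int_void_cvg :
  (\int[mu]_x (1 - void (S k (kappa k x)))%:E @[k --> \oo] -->
   \int[mu]_x (1 - void (cball (opp x) r))%:E)%E /\
  mu.-integrable setT (fun x => (1 - void (cball (opp x) r))%:E) /\
  (forall k, (\int[mu]_x (1 - void (S k (kappa k x)))%:E < +oo)%E).
Proof.
pose g (x : n.-tuple R) : \bar R := (\1_(cball origin (r + rd + 2)) x : R)%:E.
have mg : measurable_fun setT g.
  by apply/measurable_EFinP; apply: measurable_indic; exact: measurable_cball.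
have ig : mu.-integrable setT g.
  apply/integrableP; split => //.
  under eq_integral do rewrite gee0_abs ?lee_fin//.
  rewrite integral_indic// ?setIT ?cball_lebesgue_lty//; exact: measurable_cball.
pose h_ k x := (1 - void (S k (kappa k x)))%:E.
have mh_ k : measurable_fun setT (h_ k).
  apply/measurable_EFinP.
  exact: (measurable_fun_fibers (kappa k) (fun j => 1 - void (S k j))).
have mh : measurable_fun setT (fun x => (1 - void (cball (opp x) r))%:E).
  by apply/measurable_EFinP; apply: measurable_funB => //; exact: measurable_void_opp.
have void01 B := void_le1 mu ld rd ld_ge0 B.
have hg : {ae mu, forall x k, setT x -> (`|h_ k x| <= g x)%E}.
  apply: aeW => x k _; rewrite /h_ /g /=.
  have /andP[v0 v1] := void01 (S k (kappa k x)).
  rewrite lee_fin ger0_norm ?subr_ge0// indicE.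
  have [xb|xb] := pselect (cball origin (r + rd + 2) x).
    by rewrite mem_set// lerBlDr lerDl.
  by rewrite void_far// subrr.
have hcvg : {ae mu, forall x, setT x -> h_ ^~ x @ \oo --> (1 - void (cball (opp x) r))%:E}.
  apply: aeW => x _; apply: cvg_EFin; first exact: nearW.
  by apply: cvgB; [exact: cvg_cst|exact: void_cvg].
have [H1 _ H2] := dominated_convergence measurableT mh_ mh hcvg ig hg.
split => //; split => // k.
apply: le_lt_trans (_ : (_ <= \int[mu]_x g x)%E) _.
  apply: ge0_le_integral => //.
  - by move=> x _; rewrite lee_fin subr_ge0; have /andP[] := void01 (S k (kappa k x)).
  - exact: mh_.
  - move=> x _; have [xb|xb] := pselect (cball origin (r + rd + 2) x).
      rewrite /h_ /g lee_fin indicE mem_set// lerBlDr lerDl.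
      by have /andP[] := void01 (S k (kappa k x)).
    by rewrite /h_ /g lee_fin void_far// subrr indicE.
by rewrite integral_indic// ?setIT ?cball_lebesgue_lty//; exact: measurable_cball.
Qed.

Lemma proba_contact_gt_grid : P contact_gt =
  (expR (- (lp * fine (\int[mu]_x (1 - void (cball (opp x) r))%:E))))%:E.
Proof.
have [c1 [int_h Fk_lty]] := int_void_cvg.
apply: (cvg_unique _ F_cvg); first exact: ereal_hausdorff.
rewrite (_ : (fun k => _) = (fun k =>
    (expR (- (lp * fine (\int[mu]_x (1 - void (S k (kappa k x)))%:E))))%:E)).
  apply: cvg_EFin; first exact: nearW.
  apply: continuous_cvg; first exact: continuous_expR.
  apply: cvgN; apply: cvgMr; apply: fine_cvg.
  by rewrite fineK//; exact: integrable_fin_num.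
apply/funext => k.
exact: (proba_no_hits P mu lp ld rd X D mcpX ld_ge0
  (cball_lebesgue_lty mu mu_leb origin rd) (kappa k) (S k)).
Qed.

End Contact.

Lemma proba_contact_gt {R : realType} {n : nat} {d} {Omega : measurableType d}
  (P : probability Omega R) (mu : {measure set (n.-tuple R) -> \bar R}) (lp ld rd : R)
  (X : nat -> Omega -> n.-tuple R) (D : nat -> Omega -> set (n.-tuple R)) (r : R) :
  is_lebesgue_n mu -> is_mcp P mu lp ld rd X D -> 0 <= ld ->
  measurable (contact_gt X D r) /\
  P (contact_gt X D r) = (expR (- (lp * fine (\int[mu]_x
    (1 - void_proba mu ld rd (cball (tscale (-1) x) r))%:E))))%:E.
Proof.
move=> mu_leb mcpX ld0.
have /choice[kappa /choice[y Hy]] k : exists kappa : n.-tuple R -> nat,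
    exists y : nat -> n.-tuple R, (forall j, measurable (kappa @^-1` [set j])) /\
    (forall x, tnorm (tsub x (y (kappa x))) <= k.+1%:R^-1 / 2).
  by apply: exists_grid; rewrite divr_gt0// invr_gt0.
have mk k := (Hy k).1; have dk k := (Hy k).2; split.
  exact: (measurable_contact_gt P mu lp ld rd X D mcpX r kappa y).
exact: (proba_contact_gt_grid P mu mu_leb lp ld rd X D mcpX ld0 r kappa y).
Qed.

(** * The radial integral *)

Section RadialIntegral.
Context {R : realType} {n : nat} (n_gt0 : (0 < n)%N).
Local Notation leb := (@lebesgue_measure R).

Lemma integrable_weight (u : R -> R) (a b : R) : measurable_fun setT u ->
  (forall x, 0 <= u x <= 1) -> 0 <= a ->
  leb.-integrable `[a, b] (EFin \o (fun x => u x * x ^+ n.-1)).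
Proof.
move=> mu01 u01 a0.
have ab : (lebesgue_measure `[a, b]%classic < +oo)%E.
  by rewrite lebesgue_measure_itv/=; case: ifP => // _; rewrite -EFinD ltry.
apply: measurable_bounded_integrable => //.
- apply: measurable_funTS; apply: measurable_funM; first exact: mu01.
  exact: exprn_measurable.
- exists (b ^+ n.-1); split; first exact: num_real.
  move=> M bM x/=; rewrite in_itv/= => /andP[ax xb].
  have x0 := le_trans a0 ax; have /andP[u0 u1] := u01 x.
  rewrite ger0_norm ?mulr_ge0 ?exprn_ge0//; apply: le_trans (ltW bM).
  rewrite -[leRHS]mul1r ler_pM ?exprn_ge0//.
  by rewrite lerXn2r// nnegrE// (le_trans x0).
Qed.

Lemma integrable_monomial (a b : R) : 0 <= a ->
  leb.-integrable `[a, b] (EFin \o (fun x => x ^+ n.-1)).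
Proof.
move=> a0; rewrite (_ : _ \o _ = EFin \o (fun x => cst 1 x * x ^+ n.-1)).
  by apply: integrable_weight => // x; rewrite ler01 lexx.
by apply/funext => x /=; rewrite mul1r.
Qed.

Lemma Rintegral_monomial (a b : R) : 0 <= a -> a <= b ->
  n%:R * \int[leb]_(x in `[a, b]) x ^+ n.-1 = b ^+ n - a ^+ n.
Proof.
have from0 c : 0 <= c -> n%:R * \int[leb]_(x in `[0, c]) x ^+ n.-1 = c ^+ n.
  move=> c0; rewrite -RintegralZl//; last exact: integrable_monomial.
  by rewrite /Rintegral integral_monomial.
move=> a0 ab; rewrite -(from0 b) ?(le_trans a0)// -(from0 a)// -mulrBr; congr (_ * _).
rewrite Rintegral_itvB ?bnd_simp//; last exact: integrable_monomial.
rewrite Rintegral_itv_obnd_cbnd//.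
by apply: integrableS (integrable_monomial a b a0) => //; exact: subset_itv_oc_cc.
Qed.

End RadialIntegral.

Section Formula.
Context {R : realType} {n : nat} (mu : {measure set (n.-tuple R) -> \bar R}).
Context (mu_leb : is_lebesgue_n mu) (n_gt0 : (0 < n)%N).
Context (ld r rd : R) (ld_ge0 : 0 <= ld) (r_gt0 : 0 < r) (rd_gt0 : 0 < rd).
Local Notation leb := (@lebesgue_measure R).
Local Notation A := (Avol mu r rd).
Local Notation vn := (vball mu).

Lemma Avol_ge0 x : 0 <= A x.
Proof. exact/fine_ge0/measure_ge0. Qed.

Let expA01 x : 0 <= expR (- ld * A x) <= 1.
Proof. by rewrite expR_ge0/= -expR0 ler_expR mulNr oppr_le0 mulr_ge0// Avol_ge0. Qed.

Lemma Avol_far x : r + rd < x -> A x = 0.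
Proof.
move=> rx; rewrite /Avol (_ : _ `&` _ = set0) ?measure0//.
rewrite -subset0 => z; rewrite cball0E /cball/= => -[zr zx].
have x0 : 0 <= x by apply/ltW/(lt_trans _ rx)/addr_gt0.
have := tnorm_e1x x n_gt0 x0.
have := tnormD (tsub (e1x x) z) z.
rewrite (_ : tadd (tsub _ _) _ = e1x x); last first.
  by apply: eq_from_tnth => i; rewrite !tnthE; ring.
rewrite tnormN; lra.
Qed.

(** At such distances the smaller ball is contained in the larger one. *)
Lemma Avol_near x : 0 <= x -> x <= `|r - rd| -> A x = vn * Num.min r rd ^+ n.
Proof.
move=> x0 xr; have xe := tnorm_e1x x n_gt0 x0.
have mu_rd : mu (cball (e1x x) rd) = (vn * rd ^+ n)%:E.
  rewrite -lebesgue_cball0 ?ltW// -[LHS](lebesgue_tadd mu mu_leb (e1x x)); last first.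
    exact: measurable_cball.
  congr (mu _); rewrite cball0E; apply/seteqP; split => z; rewrite /cball/=;
  by rewrite (_ : tsub _ _ = z)//; apply: eq_from_tnth => i; rewrite !tnthE; ring.
rewrite /Avol; case: (leP r rd) => rrd.
  rewrite (setIidl _) ?lebesgue_cball0 ?ltW//.
  move=> z; rewrite cball0E /cball/= => zr.
  have := tnormD z (tscale (-1) (e1x x)).
  have -> : tnorm (tscale (-1) (@e1x R n x)) = tnorm (@e1x R n x).
    by apply: tnorm_eq; rewrite !tdotE; ring.
  rewrite (_ : tadd _ _ = tsub z (e1x x)); last first.
    by apply: eq_from_tnth => i; rewrite !tnthE; ring.
  by move: xr; rewrite ler0_norm ?subr_le0// xe; lra.
rewrite (setIidr _) ?mu_rd//.
move=> z; rewrite cball0E /cball/= => zr.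
have := tnormD (tsub z (e1x x)) (e1x x).
rewrite (_ : tadd _ _ = z); last first.
  by apply: eq_from_tnth => i; rewrite !tnthE; ring.
by move: xr; rewrite gtr0_norm ?subr_gt0// xe; lra.
Qed.

Lemma measurable_Avol : measurable_fun setT A.
Proof.
have me : measurable_fun setT (@e1x R n).
  apply/measurable_fun_tnthP => i.
  rewrite (_ : _ \o _ = fun x => if val i == 0%N then x else 0); last first.
    by apply/funext => x; rewrite /= tnth_mktuple.
  by case: (val i == 0%N); [exact: measurable_id|exact: measurable_cst].
apply: measurableT_comp; first exact: fine_measurable.
pose L := [set z : R * n.-tuple R | tnorm z.2 <= r /\ tnorm (tsub z.2 (e1x z.1)) <= rd].
rewrite (_ : (fun x => _) = (fun x => mu (xsection L x))).
  apply: measurable_measure_xsection; first exact: sigma_finite_lebesgue.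
  rewrite (_ : L = snd @^-1` cball origin r `&`
      (fun z : R * n.-tuple R => tsub z.2 (e1x z.1)) @^-1` cball origin rd).
    apply: measurableI; apply: measurable_preimage; try exact: measurable_cball.
      exact: measurable_snd.
    apply: (measurableT_comp measurable_tsub (measurable_fun_pair measurable_snd
      (measurableT_comp me measurable_fst))).
  by rewrite !cball0E.
apply/funext => x; congr (mu _); rewrite cball0E.
by apply/seteqP; split => z; rewrite /xsection/= inE.
Qed.

Let measurable_expA : measurable_fun setT (fun x => expR (- ld * A x)).
Proof.
apply: measurableT_comp; first exact: measurable_expR.
by apply: measurable_funM => //; exact: measurable_Avol.
Qed.

Let u x : R := 1 - expR (- ld * A x).

Let u01 x : 0 <= u x <= 1.
Proof. by have /andP[h1 h2] := expA01 x; rewrite /u subr_ge0 h2 lerBlDr lerDl. Qed.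

Let mu_u : measurable_fun setT u.
Proof. by apply: measurable_funB => //; exact: measurable_expA. Qed.

Lemma void_Avol x : void_proba mu ld rd (cball (tscale (-1) x) r) = expR (- ld * A (tnorm x)).
Proof.
rewrite /void_proba mulNr -[X in _ = expR (- (_ * X))]/(fine (A (tnorm x))%:E) -cballI_Avol//.
congr (expR (- (_ * fine _))).
rewrite -[RHS](lebesgue_tadd mu mu_leb x); last first.
  by apply: measurableI; exact: measurable_cball.
congr (mu _); rewrite !cball0E; apply/seteqP; split => z; rewrite /cball/=.
  rewrite (_ : tsub z _ = tadd x z); last by apply: eq_from_tnth => i; rewrite !tnthE; ring.
  by rewrite (_ : tsub _ x = z)//; apply: eq_from_tnth => i; rewrite !tnthE; ring.
rewrite (_ : tsub z _ = tadd x z); last by apply: eq_from_tnth => i; rewrite !tnthE; ring.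
by rewrite (_ : tsub _ x = z)//; apply: eq_from_tnth => i; rewrite !tnthE; ring.
Qed.

Lemma integral_void_radial :
  fine (\int[mu]_x (1 - void_proba mu ld rd (cball (tscale (-1) x) r))%:E) =
  vn * n%:R * \int[leb]_(x in `[0, r + rd]) ((1 - expR (- ld * A x)) * x ^+ n.-1).
Proof.
rewrite -RintegralZl//; last exact: (integrable_weight u).
rewrite /Rintegral; congr fine.
under [LHS]eq_integral do rewrite void_Avol.
rewrite (integral_tnorm mu mu_leb n_gt0 (fun x => (u x)%:E)); last 2 first.
- by apply/measurable_EFinP; exact: mu_u.
- by move=> x; rewrite lee_fin; have /andP[] := u01 x.
rewrite [LHS]integral_mkcond [RHS]integral_mkcond; apply: eq_integral => x _.
rewrite !patchE !mem_setE !in_itv/= andbT; case: (leP 0 x) => x0 //=.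
case: (leP x (r + rd)) => xr; first by rewrite -EFinM; congr EFin; rewrite /u; ring.
(* Beyond r + rd the lens is empty, which cuts the half-line down to a bounded interval. *)
by rewrite /u Avol_far// mulr0 expR0 subrr mul0e.
Qed.

(** The integral is cut at |r - rd|, below which the lens volume is constant. *)
Lemma radial_integral_split :
  n%:R * \int[leb]_(x in `[0, r + rd]) ((1 - expR (- ld * A x)) * x ^+ n.-1) =
  (r + rd) ^+ n - `|r - rd| ^+ n * expR (- ld * vn * Num.min r rd ^+ n)
  - n%:R * \int[leb]_(x in `[`|r - rd|, r + rd]) (expR (- ld * A x) * x ^+ n.-1).
Proof.
have : `|r - rd| <= r + rd.
  by rewrite ler_norml opprD lerD2r lerD2l (ge0_cp (ltW r_gt0)) (ge0_cp (ltW rd_gt0)).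
set c := `|r - rd|; set b := r + rd; set E := expR (- ld * vn * _).
move=> cb; have c0 : 0 <= c by exact: normr_ge0.
have iu s t : 0 <= s -> leb.-integrable `[s, t] (EFin \o (fun x => u x * x ^+ n.-1)).
  exact: integrable_weight.
have -> : \int[leb]_(x in `[0, b]) (u x * x ^+ n.-1) =
    \int[leb]_(x in `[0, c]) (u x * x ^+ n.-1) + \int[leb]_(x in `[c, b]) (u x * x ^+ n.-1).
  apply/eqP; rewrite addrC -subr_eq; apply/eqP.
  rewrite Rintegral_itvB ?bnd_simp//; last exact: iu.
  rewrite Rintegral_itv_obnd_cbnd//.
  by apply: integrableS (iu c b c0) => //; exact: subset_itv_oc_cc.
rewrite mulrDr.
have -> : \int[leb]_(x in `[0, c]) (u x * x ^+ n.-1) =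
    (1 - E) * \int[leb]_(x in `[0, c]) (x ^+ n.-1).
  transitivity (\int[leb]_(x in `[0, c]) ((1 - E) * x ^+ n.-1)); last first.
    by apply: RintegralZl => //; exact: integrable_monomial.
  apply: eq_Rintegral => x; rewrite inE/= in_itv/= => /andP[x0 xc].
  by rewrite /u Avol_near// /E mulrA.
have -> : \int[leb]_(x in `[c, b]) (u x * x ^+ n.-1) =
    \int[leb]_(x in `[c, b]) (x ^+ n.-1) -
    \int[leb]_(x in `[c, b]) (expR (- ld * A x) * x ^+ n.-1).
  rewrite -RintegralB//; last 2 first.
  - exact: integrable_monomial.
  - exact: (integrable_weight (fun x => expR (- ld * A x))).
  by apply: eq_Rintegral => x _; rewrite /u mulrBl mul1r.
(* The explicit terms (1 - E) c^n + b^n - c^n collapse to b^n - c^n E. *)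
have := Rintegral_monomial n_gt0 0 c (lexx 0) c0.
have := Rintegral_monomial n_gt0 c b c0 cb.
rewrite expr0n gtn_eqF// subr0 mulrBr mulrCA => -> ->.
by ring.
Qed.

End Formula.


Theorem theorem1 (R : realType) (n : nat) (d : measure_display)
  (Omega : measurableType d) (P : probability Omega R)
  (mu : {measure set (n.-tuple R) -> \bar R})
  (lp ld rd : R) (X : nat -> Omega -> n.-tuple R)
  (D : nat -> Omega -> set (n.-tuple R)) :
  (0 < n)%N -> is_lebesgue_n mu ->
  0 < lp -> 0 < ld -> 0 < rd ->
  is_mcp P mu lp ld rd X D ->
  forall r : R, 0 < r ->
  let F := P [set w | (contact_dist (mcp X D) w <= r%:E)%E] in
  let vn := vball mu in
  let A := Avol mu r rd in
  F = (1 - expR (- (vn * n%:R * lp *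
         Rintegral lebesgue_measure `[0, r + rd]
           (fun x => (1 - expR (- ld * A x)) * x ^+ n.-1))))%:E /\
  F = (1 - expR (- (vn * lp *
         ((r + rd) ^+ n
          - `|r - rd| ^+ n * expR (- ld * vn * (Num.min r rd) ^+ n)
          - n%:R * Rintegral lebesgue_measure `[`|r - rd|, r + rd]
                     (fun x => expR (- ld * A x) * x ^+ n.-1)))))%:E.
Proof.
move=> n_gt0 mu_leb lp_gt0 ld_gt0 rd_gt0 mcpX r r_gt0 F vn A.
have ld_ge0 := ltW ld_gt0.
have [mE PE] := proba_contact_gt P mu lp ld rd X D r mu_leb mcpX ld_ge0.
have FE : F = (1 - expR (- (lp * (vn * n%:R * Rintegral lebesgue_measure `[0, r + rd]
    (fun x => (1 - expR (- ld * A x)) * x ^+ n.-1)))))%:E.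
  rewrite EFinB -integral_void_radial// -PE -probability_setC// /F; congr (P _).
  by apply/seteqP; split => w /=; rewrite /contact_gt/= leNgt => /negP.
rewrite FE; split; congr (1 - expR (- _))%:E; first by ring.
by rewrite -radial_integral_split//; ring.
Qed.
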